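(* Let $\beta\in(2,3)$. For each fixed $t\in[0,T]$, almost surely the map $x\mapsto Y(t,x)$ is (up to modification) Hölder continuous on $\mathbb{T}$ of order $\delta$ for every $0<\delta<\frac{2}{\beta}$. Consequently, for each fixed $t\in[0,T]$, almost surely the map $x\mapsto u(t,x)=X(t,x)+Y(t,x)$ is (up to modification) Hölder continuous of order $\delta$ for every $0<\delta<\frac12$.
   Context: Fix $T>0$. $\mathbb{T}=\mathbb{R}/\mathbb{Z}$ is the one-dimensional flat torus, identified with $[0,1)$ with periodic boundary conditions. $p_t(x)=\sum_{k\in\mathbb{Z}}\frac{1}{\sqrt{4\pi t}}e^{-(x-k)^2/(4t)}$ is the periodic heat kernel. $W$ is a space-time Gaussian white noise on $[0,T]\times\mathbb{T}$, i.e. a centered Gaussian family with $\mathbf{E}[W(A)W(B)]=\lambda(A\cap B)$ for Borel $A,B\subset[0,T]\times\mathbb{T}$, $\lambda$ being Lebesgue measure. Let $f(u)=u-u^3$, and let $u$ be the unique mild solution, with zero initial condition, of the stochastic Allen--Cahn equation $\partial_t u=\partial_x^2u+f(u)+\dot W$ on $[0,T]\times\mathbb{T}$, i.e. $u=X+Y$ with $$X(t,x)=\int_0^t\!\int_{\mathbb{T}}p_{t-s}(x-y)\,W(ds,dy),\qquad Y(t,x)=\int_0^t\!\int_{\mathbb{T}}p_{t-s}(x-y)f(u(s,y))\,dy\,ds;$$ it satisfies $\sup_{t\in[0,T],x\in\mathbb{T}}\mathbf{E}|u(t,x)|^q<\infty$ for all $q\ge2$. *)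

(* Defs.v *)
From HB Require Import structures.
From mathcomp Require Import all_boot all_order all_algebra.
From mathcomp Require Import all_classical all_reals all_analysis.

Set Implicit Arguments.
Unset Strict Implicit.
Unset Printing Implicit Defensive.

Import Order.TTheory GRing.Theory Num.Theory.
Import numFieldNormedType.Exports.

Local Open Scope classical_set_scope.
Local Open Scope ring_scope.

(* The torus R/Z is represented by its fundamental domain [0, 1[; a function
   on the torus is a function on R of which only the values on [0, 1[ matter. *)
Definition torus (R : realType) : set R := `[0, 1[%classic.

(* The quotient distance min_k |x - y - k|, for x, y in [0, 1[. *)
Definition torus_dist (R : realType) (x y : R) : R :=
  Num.min `|x - y| (1 - `|x - y|).

Definition torus_holder (R : realType) (delta : R) (g : R -> R) : Prop :=
  exists C : R, forall x y : R, torus x -> torus y ->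
    `|g x - g y| <= C * torus_dist x y `^ delta.

(* For t <= 0 this is 0, since then sqrt (4 pi t) = 0 and 0^-1 = 0. *)
Definition heat_kernel (R : realType) (t x : R) : R :=
  fine (\esum_(k in [set: int])
    ((Num.sqrt (4 * pi * t))^-1 * expR (- (x - k%:~R) ^+ 2 / (4 * t)))%:E).

Definition spacetime (R : realType) (T : R) : set (R * R) :=
  `[0, T]%classic `*` @torus R.

Notation lambda2 R := (@lebesgue_measure R \x @lebesgue_measure R)%E.

Section noise.
Context {d : measure_display} {Omega : measurableType d} {R : realType}.
Variable P : probability Omega R.

(* [normal_prob 0 0] is not the degenerate Gaussian law (it is a junk value),
   whence the separate Dirac case. *)
Definition centered_gaussian (X : Omega -> R) : Prop :=
  measurable_fun [set: Omega] X /\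
  exists sigma : R, forall B : set R, measurable B ->
    P (X @^-1` B) = if sigma == 0 then \d_(0 : R) B else normal_prob 0 sigma B.

(* A linear combination of sets: a list of pairs (coefficient, set), with its
   step function and its image by the noise. *)
Definition step_fun (h : seq (R * set (R * R))) (z : R * R) : R :=
  \sum_(cA <- h) cA.1 * \1_(cA.2) z.

Definition step_noise (W : set (R * R) -> Omega -> R)
    (h : seq (R * set (R * R))) (w : Omega) : R :=
  \sum_(cA <- h) cA.1 * W cA.2 w.

Definition step_on (D : set (R * R)) (h : seq (R * set (R * R))) : Prop :=
  forall cA, cA \in h -> measurable cA.2 /\ cA.2 `<=` D.

(* A family of variables is (jointly) Gaussian when all its finite linear
   combinations are Gaussian. *)
Definition white_noise (T : R) (W : set (R * R) -> Omega -> R) : Prop :=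
  (forall h, step_on (spacetime T) h -> centered_gaussian (step_noise W h)) /\
  (forall A B : set (R * R),
    measurable A -> A `<=` spacetime T ->
    measurable B -> B `<=` spacetime T ->
    ('E_P[fun w => (W A w * W B w)%R] = lambda2 R (A `&` B))%E).

(* [I] is (a version of) the Wiener integral of [phi] over [D]: the L^2(P)
   limit of the noise of step functions converging to [phi] in L^2(D). By the
   isometry property it is unique up to a.s. equality. *)
Definition wiener_integral (W : set (R * R) -> Omega -> R) (D : set (R * R))
    (phi : R * R -> R) (I : Omega -> R) : Prop :=
  measurable_fun [set: Omega] I /\
  exists h : nat -> seq (R * set (R * R)),
    [/\ forall n, step_on D (h n),
        (fun n => \int[lambda2 R]_(z in D)
           ((phi z - step_fun (h n) z) ^+ 2)%:E)%E @ \oo --> 0%E &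
        (fun n => 'E_P[fun w => ((I w - step_noise W (h n) w) ^+ 2)%R])%E
          @ \oo --> 0%E].

Definition stochastic_convolution (T : R) (W : set (R * R) -> Omega -> R)
    (X : R -> R -> Omega -> R) : Prop :=
  forall t x, 0 <= t <= T -> torus x ->
    wiener_integral W (spacetime t)
      (fun sy => heat_kernel (t - sy.1) (x - sy.2)) (X t x).

Definition reaction (v : R) : R := v - v ^+ 3.

Definition drift_part (u : R -> R -> Omega -> R) (t x : R) (w : Omega) : R :=
  \int[lebesgue_measure]_(s in `[0, t])
    \int[lebesgue_measure]_(y in @torus R)
      (heat_kernel (t - s) (x - y) * reaction (u s y w)).

(* [u] is a random field, so that u = X + Y holds for each (t, x), a.s.
   The integrals in Y make sense a.s. as soon as the moments of [u] are
   bounded in the sense of [bounded_moments]. *)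
Definition mild_solution (T : R) (W : set (R * R) -> Omega -> R)
    (X u : R -> R -> Omega -> R) : Prop :=
  [/\ stochastic_convolution T W X,
      measurable_fun (spacetime T `*` [set: Omega])
        (fun z : (R * R) * Omega => u z.1.1 z.1.2 z.2) &
      forall t x, 0 <= t <= T -> torus x ->
        {ae P, forall w, u t x w = X t x w + drift_part u t x w}].

Definition bounded_moments (T : R) (u : R -> R -> Omega -> R) : Prop :=
  forall q : R, 2 <= q ->
    (ereal_sup [set 'E_P[fun w => (`|u tx.1 tx.2 w| `^ q)%R] | tx in spacetime T]
      < +oo)%E.

Definition modification (f g : R -> Omega -> R) : Prop :=
  forall x, torus x ->
    measurable_fun [set: Omega] (g x) /\ {ae P, forall w, g x w = f x w}.

Definition as_holder_below (delta0 : R) (f : R -> Omega -> R) : Prop :=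
  exists2 g : R -> Omega -> R, modification f g &
    {ae P, forall w, forall delta : R, 0 < delta < delta0 ->
      torus_holder delta (fun x => g x w)}.

End noise.

(* Main.v *)
Require Import Defs.
From HB Require Import structures.
From mathcomp Require Import all_boot all_order all_algebra.
From mathcomp Require Import ring lra zify.
From mathcomp Require Import all_classical all_reals all_analysis.
From mathcomp Require Import measurable_realfun.

Import Order.TTheory GRing.Theory Num.Theory.
Import numFieldNormedType.Exports.

Local Open Scope classical_set_scope.
Local Open Scope ring_scope.

(** The solution is the sum of the stochastic convolution X and of the drift
    part Y. At a fixed time t the two are treated by different means.

    The periodic heat kernel p satisfies, for 0 < eta <= 1 and s <= T,
      |p_s(x) - p_s(y)| <= C s^(-(1 + eta)/2) d(x, y)^eta
    with d the distance of the torus ([heat_kernel_torus_holder]). For eta < 1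
    the singularity in s is integrable, which carries both halves.

    For Y, integrating this bound against f(u) gives
      |Y(t, x) - Y(t, y)| <= C d(x, y)^eta K,
      K = int_0^t (t - s)^(-(1 + eta)/2) int |f(u(s, z))| dz ds
    ([iterated_Rintegral_dist_le]). The random constant K is almost surely
    finite because its expectation is: by Tonelli's theorem it only involves
    E |f(u(s, z))|, which the third moments of u bound uniformly. Since
    2 / beta < 1, one may take eta = 2 / beta, and smaller exponents follow
    ([drift_part_as_holder]). Here Y is its own modification.

    For X, the increment X(t, x) - X(t, y) is an L^2 limit of Gaussian
    variables whose variances are controlled, through the isometry of the
    noise, by int int |p_(t-s)(x - z) - p_(t-s)(y - z)|^2 dz ds. One factor of
    the square is bounded by the inequality above, the other one has bounded
    mass, so this is at most K d(x, y)^eta for each eta < 1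
    ([heat_kernel_increment_L2]). Gaussian tails survive the limit
    ([wiener_integral_sub_tail]): for delta < 1/2, the probability of
    |X(t, x) - X(t, y)| > d(x, y)^delta is smaller than any power of d(x, y).
    Kolmogorov's chaining argument along the dyadic points of the torus
    ([kolmogorov_torus]) then produces a modification of X(t, .) that is
    Hoelder continuous of all orders below 1/2 ([stochastic_convolution_holder]).
    Adding the two parts gives the claim for u, as 1/2 < 1. *)

(** * Gaussian increments and lattice sums *)

Section gauss.
Context {R : realType}.
Implicit Types t u v : R.

Lemma expRN_le_inv (a : R) : 0 <= a -> expR (- a) <= (1 + a)^-1.
Proof.
move=> a0; rewrite expRN lef_pV2 ?posrE ?expR_gt0 ?ltr_wpDr//.
exact: expR_ge1Dx.
Qed.

(** Interpolation between the trivial bound and the Lipschitz bound. In units of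
    sqrt t, let r be the distance of u and v. For r >= 1 the difference is at
    most the larger value; for r <= 1 the inequality 1 - exp (- x) <= x gives r
    times a factor that is linear in |u|, absorbed by half of the Gaussian.
    This is why the variance doubles on the right. *)
Lemma gauss_increment_le (t u v eta : R) : 0 < t -> 0 <= eta <= 1 ->
  `|expR (- u ^+ 2 / (4 * t)) - expR (- v ^+ 2 / (4 * t))| <=
  2 * (`|u - v| * t `^ (- 2^-1)) `^ eta *
    (expR (- u ^+ 2 / (8 * t)) + expR (- v ^+ 2 / (8 * t))).
Proof.
move=> t0 /andP[e0 e1].
wlog uv : u v / u ^+ 2 <= v ^+ 2 => [H|].
  have [uv|/ltW vu] := leP (u ^+ 2) (v ^+ 2); first exact: H.
  rewrite distrC (distrC u) (addrC (expR (- u ^+ 2 / (8 * t)))); exact: H.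
set st := t `^ (- 2^-1).
have st0 : 0 < st by rewrite powR_gt0.
have stt : st ^+ 2 = t^-1.
  rewrite -powR_mulrn ?powR_ge0// -powRrM mulNr mulVf//.
  by rewrite powR_inv1 ?ltW.
pose a := `|u| * st; pose r := `|u - v| * st.
have a0 : 0 <= a by rewrite mulr_ge0// ltW.
have r0 : 0 <= r by rewrite mulr_ge0// ltW.
have uE : - u ^+ 2 / (4 * t) = - (a ^+ 2 / 4).
  rewrite /a exprMn stt real_normK ?num_real// invfM; field; lra.
have uE2 : - u ^+ 2 / (8 * t) = - (a ^+ 2 / 8).
  rewrite /a exprMn stt real_normK ?num_real// invfM; field; lra.
have vE : - v ^+ 2 / (4 * t) = - ((`|v| * st) ^+ 2 / 4).
  rewrite exprMn stt real_normK ?num_real// invfM; field; lra.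
have var : `|v| * st <= a + r.
  rewrite /a /r -mulrDl ler_pM2r//.
  by rewrite -[v in `|v|](subKr u) ler_normB.
have h : 0 <= expR (- u ^+ 2 / (4 * t)) - expR (- v ^+ 2 / (4 * t)).
  by rewrite subr_ge0 ler_expR ler_pM2r ?invr_gt0 ?mulr_gt0// lerN2.
rewrite ger0_norm//.
have r_eta : 2 * r `^ eta * expR (- u ^+ 2 / (8 * t)) <=
   2 * r `^ eta * (expR (- u ^+ 2 / (8 * t)) + expR (- v ^+ 2 / (8 * t))).
  by rewrite ler_wpM2l ?mulr_ge0 ?powR_ge0// lerDl expR_ge0.
apply: le_trans r_eta.
have [r1|r1] := leP 1 r.
  have : 1 <= r `^ eta by rewrite -(powRr0 r); apply: ler_powR.
  move=> re1; apply: (@le_trans _ _ (expR (- u ^+ 2 / (8 * t)))).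
    rewrite (le_trans (y := expR (- u ^+ 2 / (4 * t))))//.
      by rewrite lerBlDr lerDl expR_ge0.
    rewrite ler_expR uE uE2 lerN2; nra.
  rewrite ler_peMl ?expR_ge0//; lra.
have rre : r <= r `^ eta.
  have [->|rn0] := eqVneq r 0; first by rewrite powR_ge0.
  by apply: ger1_powR => //; rewrite lt_neqAle eq_sym rn0 r0 ltW.
apply: (@le_trans _ _ (2 * r * expR (- u ^+ 2 / (8 * t)))); last first.
  by rewrite ler_wpM2r ?expR_ge0// ler_wpM2l.
have half : expR (- u ^+ 2 / (4 * t)) = expR (- u ^+ 2 / (8 * t)) * expR (- u ^+ 2 / (8 * t)).
  by rewrite -expRD uE uE2; congr expR; field.
have step : expR (- u ^+ 2 / (4 * t)) - expR (- v ^+ 2 / (4 * t)) <=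
    expR (- u ^+ 2 / (4 * t)) * (r * (2 * a + 1) / 4).
  set B := - v ^+ 2 / (4 * t); set A := - u ^+ 2 / (4 * t).
  have -> : expR B = expR A * expR (B - A) by rewrite -expRD; congr expR; ring.
  rewrite -{1}(mulr1 (expR A)) -mulrBr ler_wpM2l ?expR_ge0//.
  have := expR_ge1Dx (B - A).
  have : B - A >= - (r * (2 * a + 1) / 4).
    rewrite /A /B uE vE.
    have : (`|v| * st) ^+ 2 <= (a + r) ^+ 2.
      by rewrite lerXn2r// nnegrE ?addr_ge0// mulr_ge0// ltW.
    nra.
  lra.
apply: (le_trans step); rewrite half.
set e := expR (- u ^+ 2 / (8 * t)).
have e0' : 0 <= e by exact: expR_ge0.
have key : e * (2 * a + 1) <= 8.
  have : e <= (1 + a ^+ 2 / 8)^-1.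
    by rewrite /e uE2; apply: expRN_le_inv; rewrite divr_ge0// sqr_ge0.
  have b0 : 0 < 1 + a ^+ 2 / 8 by nra.
  move=> He; apply: (@le_trans _ _ ((1 + a ^+ 2 / 8)^-1 * (2 * a + 1))).
    by rewrite ler_wpM2r//; lra.
  by rewrite mulrC ler_pdivrMr//; nra.
have -> : e * e * (r * (2 * a + 1) / 4) = (r * e) * (e * (2 * a + 1)) / 4.
  by field.
have -> : 2 * r * e = (r * e) * 8 / 4 by field.
by rewrite ler_pM2r// ler_wpM2l// mulr_ge0.
Qed.

(** Listing the integers as n and -(n + 1) turns a sum over the lattice into a
    series, for which termwise integration and measurability are available. *)
Lemma esum_int (a : int -> \bar R) : (forall k, (0 <= a k)%E) ->
  (\esum_(k in [set: int]) a k = \sum_(n <oo) (a (Posz n) + a (Negz n)))%E.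
Proof.
move=> a0.
rewrite (esumID (range Posz)); last by [].
rewrite !setTI.
have -> : ~` range Posz = range Negz.
  apply/seteqP; split => [[n|n] /= H|_ [n _ <-] [m _]//].
  - by exfalso; apply: H; exists n.
  - by exists n.
rewrite !esum_image; [|by move=> ? ? _ _ []..].
rewrite nneseriesD; [|by move=> *; exact: a0..].
by rewrite -!nneseries_esumT.
Qed.

End gauss.

Section lattice.
Context {R : realType}.
Implicit Types t u v x : R.

Lemma nneseries_le_partial (a : nat -> \bar R) (c : \bar R) :
  (forall n, (0 <= a n)%E) ->
  (forall n, (\sum_(0 <= i < n) a i <= c)%E) -> (\sum_(n <oo) a n <= c)%E.
Proof.
move=> a0 ac; apply: lime_le; first by apply: is_cvg_nneseries => n _ _.
by apply: nearW => n; exact: ac.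
Qed.

(** Comparison with a geometric series: (x - k)^2 >= |k| / 2 - 4 when |x| <= 2,
    so the term of index k is at most K q^|k| with q = exp (- 1 / (16 T)). The
    range |x| <= 2 contains the differences of two points of the torus, also
    after a shift by one period. *)
Lemma lattice_gauss_le (T : R) : 0 < T -> exists C : R, 0 <= C /\
  forall t x, 0 < t <= T -> `|x| <= 2 ->
  (\esum_(k in [set: int]) (expR (- (x - k%:~R) ^+ 2 / (8 * t)))%:E <= C%:E)%E.
Proof.
move=> T0; pose q := expR (- (16 * T)^-1).
have q0 : 0 < q by exact: expR_gt0.
have q1 : q < 1 by rewrite /q -expR0 ltr_expR oppr_lt0 invr_gt0 mulr_gt0.
pose K := expR ((2 * T)^-1).
have K0 : 0 < K by exact: expR_gt0.
exists (2 * K / (1 - q)); split.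
  by rewrite divr_ge0 ?mulr_ge0 ?ltW// subr_gt0.
move=> t x /andP[t0 tT] x2.
rewrite esum_int; last by move=> k; rewrite lee_fin expR_ge0.
have x4 : x ^+ 2 <= 4.
  by rewrite -real_normK ?num_real//; have := normr_ge0 x; nra.
have term (k : int) (n : nat) : (n%:R <= (k%:~R : R) ^+ 2) ->
    expR (- (x - k%:~R) ^+ 2 / (8 * t)) <= K * q ^+ n.
  move=> nk; rewrite /K /q -expRM_natr -expRD ler_expR.
  rewrite mulNr lerNl opprD mulNr opprK.
  have T8 : (8 * T)^-1 * (x - k%:~R) ^+ 2 <= (x - k%:~R) ^+ 2 / (8 * t).
    rewrite mulrC ler_wpM2l ?sqr_ge0// lef_pV2 ?posrE ?mulr_gt0//.
    by rewrite ler_pM2l.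
  apply: le_trans T8.
  have -> : (2 * T)^-1 = (8 * T)^-1 * 4 by field; lra.
  have -> : (16 * T)^-1 * n%:R = (8 * T)^-1 * (n%:R / 2) by field; lra.
  rewrite -mulrN -mulrDr; apply: ler_wpM2l; first by rewrite invr_ge0 mulr_ge0// ltW.
  (* From (2 y - j)^2 >= 0. *)
  have sq (y j m : R) : y ^+ 2 <= 4 -> m <= j ^+ 2 -> - 4 + m / 2 <= (y - j) ^+ 2.
    by move=> y4 mj; have := sqr_ge0 (2 * y - j); nra.
  exact: sq.
apply: nneseries_le_partial => n.
  by rewrite adde_ge0// lee_fin expR_ge0.
apply: (@le_trans _ _ (\sum_(0 <= i < n) (2 * K * q ^+ i)%:E)%E).
  apply: lee_sum => i _; rewrite -EFinD lee_fin.
  rewrite (_ : 2 * K * q ^+ i = K * q ^+ i + K * q ^+ i); last by ring.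
  apply: lerD.
    apply: term; rewrite pmulrn -natrX ler_nat.
    by case: i => // i; rewrite expnS expn1 leq_pmull.
  apply: term; rewrite NegzE mulrNz sqrrN -pmulrn -natrX ler_nat.
  by rewrite expnS expn1 (leq_trans (leqnSn _))// leq_pmull.
rewrite sumEFin lee_fin big_mkord -mulr_sumr; apply: ler_wpM2l.
  by rewrite mulr_ge0// ltW.
have := subrX1 q n; have : 0 < q ^+ n by rewrite exprn_gt0.
by rewrite -[leRHS]mul1r ler_pdivlMr ?subr_gt0//; nra.
Qed.

End lattice.

(** * The periodic heat kernel *)

Section heat_kernel.
Context {R : realType}.
Implicit Types t u v x y z : R.

(** The kernel on the line, of which [heat_kernel] is the periodisation. It is 0
    for t <= 0, because the square root and its inverse are then 0. *)
Definition heat_term t u : R :=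
  (Num.sqrt (4 * pi * t))^-1 * expR (- u ^+ 2 / (4 * t)).

Lemma heat_term_ge0 t u : 0 <= heat_term t u.
Proof. by rewrite mulr_ge0 ?invr_ge0 ?sqrtr_ge0 ?expR_ge0. Qed.

Lemma inv_sqrt_powR t : 0 <= t -> (Num.sqrt t)^-1 = t `^ (- 2^-1).
Proof. by move=> t0; rewrite powRN powR12_sqrt. Qed.

Lemma heat_peak_le t : 0 < t -> (Num.sqrt (4 * pi * t))^-1 <= t `^ (- 2^-1).
Proof.
move=> t0; rewrite -inv_sqrt_powR ?(ltW t0)// lef_pV2 ?posrE ?sqrtr_gt0 ?mulr_gt0 ?pi_gt0//.
rewrite ler_wsqrtr// ler_peMl ?(ltW t0)//; have := @pi_ge2 R; lra.
Qed.

Lemma heat_term_le t u : 0 < t ->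
  heat_term t u <= t `^ (- 2^-1) * expR (- u ^+ 2 / (8 * t)).
Proof.
move=> t0; apply: ler_pM; rewrite ?invr_ge0 ?sqrtr_ge0 ?expR_ge0 ?heat_peak_le//.
rewrite ler_expR !mulNr lerN2 ler_wpM2l ?sqr_ge0// lef_pV2 ?posrE ?mulr_gt0//.
by rewrite ler_pM2r//; lra.
Qed.

Lemma heat_kernel_np t x : t <= 0 -> heat_kernel t x = 0.
Proof.
move=> t0; rewrite /heat_kernel esum1// => k _.
by rewrite ler0_sqrtr ?invr0 ?mul0r// mulr_ge0_le0// mulr_ge0// pi_ge0.
Qed.

Lemma heat_kernel_ge0 t x : 0 <= heat_kernel t x.
Proof.
apply/fine_ge0/esum_ge0 => k _; rewrite lee_fin; exact: heat_term_ge0.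
Qed.

Lemma heat_kernel_periodic t x : heat_kernel t (x + 1) = heat_kernel t x.
Proof.
rewrite /heat_kernel (reindex_esum [set: int] [set: int] (fun k : int => k + 1)).
  congr fine; apply: eq_esum => k _.
  by rewrite intrD opprD addrACA subrr addr0.
split => //; first by move=> a b _ _ /addIr.
by move=> k _; exists (k - 1) => //; rewrite subrK.
Qed.

End heat_kernel.

Section heat_bounds.
Context {R : realType}.
Implicit Types t u v x y z : R.

Lemma esum_intZl (c : R) (f : int -> R) : (forall k, 0 <= f k) -> 0 <= c ->
  (\esum_(k in [set: int]) (c * f k)%:E =
   c%:E * \esum_(k in [set: int]) (f k)%:E)%E.
Proof.
move=> f0 c0; rewrite !esum_int; first last.
- by move=> k; rewrite lee_fin mulr_ge0.
- by move=> k; rewrite lee_fin.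
rewrite -nneseriesZl; last by move=> n _; rewrite adde_ge0// lee_fin.
by apply: eq_eseriesr => n _; rewrite muleDr// fin_num_adde_defr.
Qed.

(** All three bounds come from the lattice sum of Gaussians of variance doubled:
    the normalisation contributes t^(-1/2), and the increments of the Gaussian
    contribute t^(-eta/2) more. *)
Lemma heat_kernel_bounds (T : R) : 0 < T -> exists C : R, 0 <= C /\
  forall t x, 0 < t <= T -> `|x| <= 2 ->
  [/\ ((heat_kernel t x)%:E = \esum_(k in [set: int]) (heat_term t (x - k%:~R))%:E)%E,
     heat_kernel t x <= C * t `^ (- 2^-1) &
     forall y eta, `|y| <= 2 -> 0 <= eta <= 1 ->
     heat_kernel t x - heat_kernel t y <=
       C * t `^ (- ((1 + eta) / 2)) * `|x - y| `^ eta].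
Proof.
move=> T0; have [C [C0 HC]] := lattice_gauss_le T T0.
exists (4 * C); split; first by rewrite mulr_ge0.
have fin t x : 0 < t <= T -> `|x| <= 2 ->
    (\esum_(k in [set: int]) (heat_term t (x - k%:~R))%:E <= (C * t `^ (- 2^-1))%:E)%E.
  move=> tT x2; have /andP[t0 _] := tT.
  apply: (@le_trans _ _ (\esum_(k in [set: int])
      (t `^ (- 2^-1) * expR (- (x - k%:~R) ^+ 2 / (8 * t)))%:E)).
    by apply: le_esum => k _; rewrite lee_fin; exact: heat_term_le.
  rewrite esum_intZl ?powR_ge0//.
  by rewrite (mulrC C) EFinM; apply: lee_wpmul2l; rewrite ?lee_fin ?powR_ge0//; exact: HC.
have EE t x : 0 < t <= T -> `|x| <= 2 -> ((heat_kernel t x)%:E =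
    \esum_(k in [set: int]) (heat_term t (x - k%:~R))%:E)%E.
  move=> tT x2; rewrite /heat_kernel fineK// ge0_fin_numE.
    by rewrite (le_lt_trans (fin _ _ tT x2))// ltry.
  by apply: esum_ge0 => k _; rewrite lee_fin heat_term_ge0.
move=> t x tT x2; split; [exact: EE| |].
  rewrite -lee_fin EE// (le_trans (fin _ _ tT x2))// lee_fin.
  rewrite ler_wpM2r ?powR_ge0//; lra.
move=> y eta y2 /andP[e0 e1]; have /andP[t0 _] := tT.
rewrite lerBlDr -lee_fin EFinD !EE//.
pose c := 2 * t `^ (- 2^-1) * (`|x - y| * t `^ (- 2^-1)) `^ eta.
pose D (k : int) := (expR (- (x - k%:~R) ^+ 2 / (8 * t)) +
  expR (- (y - k%:~R) ^+ 2 / (8 * t))).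
have D0 k : 0 <= D k by rewrite addr_ge0 ?expR_ge0.
have c0 : 0 <= c by rewrite !mulr_ge0 ?powR_ge0.
apply: (@le_trans _ _ (\esum_(k in [set: int])
    ((c * D k)%:E + (heat_term t (y - k%:~R))%:E))).
  apply: le_esum => k _; rewrite -EFinD lee_fin -lerBlDr.
  rewrite /heat_term -mulrBr.
  apply: (le_trans (ler_norm _)); rewrite normrM ger0_norm ?invr_ge0 ?sqrtr_ge0//.
  have := @gauss_increment_le _ t (x - k%:~R) (y - k%:~R) eta t0.
  rewrite e0 e1 => /(_ isT); rewrite (_ : x - _ - _ = x - y); last by ring.
  move=> H; have p0 : 0 <= (Num.sqrt (4 * pi * t))^-1 :> R.
    by rewrite invr_ge0 sqrtr_ge0.
  apply: (le_trans (ler_pM p0 (normr_ge0 _) (heat_peak_le _ t0) H)).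
  by rewrite /c /D le_eqVlt; apply/orP; left; apply/eqP; ring.
rewrite esumD; [|by move=> k _; rewrite lee_fin mulr_ge0|by move=> k _; rewrite lee_fin heat_term_ge0].
apply: leeD => //; rewrite esum_intZl//.
apply: (@le_trans _ _ (c%:E * (2 * C)%:E)%E).
  apply: lee_wpmul2l; first by rewrite lee_fin.
  have -> : (2 * C)%:E = (C%:E + C%:E)%E by rewrite -EFinD; congr EFin; ring.
  rewrite /D; under eq_esum do rewrite EFinD.
  rewrite esumD; [|by move=> k _; rewrite lee_fin expR_ge0..].
  by apply: leeD; exact: HC.
rewrite -EFinM lee_fin /c powRM ?powR_ge0// -powRrM.
rewrite (_ : - ((1 + eta) / 2) = - 2^-1 + (- 2^-1 * eta)); last by field.
rewrite powRD; last by rewrite (gt_eqF t0) implybT.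
by rewrite le_eqVlt; apply/orP; left; apply/eqP; ring.
Qed.

(** The estimate on the line is applied to x - z and y - z, or, when the torus
    distance is realised across the point 0, after moving one of them by a
    period. *)
Lemma heat_kernel_torus_holder (T eta : R) : 0 < T -> 0 < eta <= 1 ->
  exists C : R, 0 <= C /\ forall t x y z, t <= T -> torus x -> torus y -> torus z ->
   `|heat_kernel t (x - z) - heat_kernel t (y - z)| <=
     C * t `^ (- ((1 + eta) / 2)) * torus_dist x y `^ eta.
Proof.
move=> T0 /andP[e0 e1]; have [C [C0 HC]] := heat_kernel_bounds T T0.
exists C; split => // t x y z tT.
have [t0|t0] := leP t 0.
  by rewrite !heat_kernel_np// subrr normr0 !mulr_ge0 ?powR_ge0.
rewrite /torus /= !in_itv/= => /andP[x0 x1] /andP[y0 y1] /andP[z0 z1].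
have inc a b : `|a| <= 2 -> `|b| <= 2 ->
    `|heat_kernel t a - heat_kernel t b| <=
       C * t `^ (- ((1 + eta) / 2)) * `|a - b| `^ eta.
  move=> a2 b2; have tT' : 0 < t <= T by rewrite t0.
  have e01 : 0 <= eta <= 1 by rewrite ltW.
  have [_ _ /(_ b eta b2 e01) Hab] := HC t a tT' a2.
  have [_ _ /(_ a eta a2 e01) Hba] := HC t b tT' b2.
  by rewrite ler_norml Hab andbT lerNl opprB distrC.
wlog xy : x y x0 x1 y0 y1 / x <= y => [H|].
  have [|/ltW yx] := leP x y; first exact: H.
  by rewrite distrC /torus_dist (distrC x); exact: H.
rewrite /torus_dist /Num.min; case: ifPn => _.
  have -> : x - y = (x - z) - (y - z) by ring.
  by apply: inc; rewrite ler_norml; lra.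
(* Here x <= y, so x is the point to be moved by a period. *)
rewrite -(heat_kernel_periodic t (x - z)).
have -> : 1 - `|x - y| = `|x - z + 1 - (y - z)|.
  by rewrite ler0_norm ?subr_le0// ger0_norm; lra.
by apply: inc; rewrite ler_norml; lra.
Qed.

(** The exponent 1/2 is the true one; larger exponents are allowed so that a
    single weight in time can control both the kernel and its increments. *)
Lemma heat_kernel_torus_le (T a : R) : 0 < T -> 2^-1 <= a ->
  exists C : R, 0 <= C /\ forall t x y, t <= T -> torus x -> torus y ->
   heat_kernel t (x - y) <= C * t `^ (- a).
Proof.
move=> T0 a2; have [C [C0 HC]] := heat_kernel_bounds T T0.
exists (C * T `^ (a - 2^-1)); split => [|t x y tT]; first by rewrite mulr_ge0 ?powR_ge0.
have [t0|t0] := leP t 0; first by rewrite heat_kernel_np// !mulr_ge0 ?powR_ge0.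
rewrite /torus /= !in_itv/= => /andP[x0 x1] /andP[y0 y1].
have xy2 : `|x - y| <= 2 by rewrite ler_norml; lra.
have tT' : 0 < t <= T by rewrite t0.
have [_ /le_trans + _] := HC t (x - y) tT' xy2; apply.
rewrite -mulrA; apply: ler_wpM2l => //.
have -> : t `^ (- 2^-1) = t `^ (a - 2^-1) * t `^ (- a).
  rewrite -powRD; last by rewrite (gt_eqF t0) implybT.
  by congr powR; ring.
apply: ler_wpM2r; first exact: powR_ge0.
by apply: ge0_ler_powR; rewrite ?subr_ge0// nnegrE ltW.
Qed.

End heat_bounds.

(** * Mass and measurability of the heat kernel *)

Section heat_mass.
Context {R : realType}.
Implicit Types t u v x y z : R.
Local Notation mu := lebesgue_measure.

(** Replacing the Gaussian by a Cauchy density keeps the right order of decay in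
    t and gives an explicit primitive, the arctangent. *)
Lemma heat_term_le_cauchy t u : 0 < t ->
  heat_term t u <= (Num.sqrt (4 * t))^-1 / (1 + ((Num.sqrt (4 * t))^-1 * u) ^+ 2).
Proof.
move=> t0; have t4 : 0 < 4 * t by rewrite mulr_gt0.
apply: ler_pM; rewrite ?invr_ge0 ?sqrtr_ge0 ?expR_ge0//.
  rewrite lef_pV2 ?posrE ?sqrtr_gt0 ?mulr_gt0 ?pi_gt0// ler_wsqrtr//.
  by have := @pi_ge2 R; nra.
rewrite mulNr exprMn exprVn sqr_sqrtr ?(ltW t4)// [_^-1 * u ^+ 2]mulrC.
by apply: expRN_le_inv; rewrite divr_ge0 ?sqr_ge0 ?(ltW t4).
Qed.

Lemma is_derive_atan_affine (b c x : R) :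
  is_derive x 1 (fun y => atan (b * (y + c))) (b / (1 + (b * (x + c)) ^+ 2)).
Proof.
have h : is_derive x 1 (fun y => b * (y + c)) b.
  by apply: is_derive_eq; rewrite addr0 scaler1.
by rewrite mulrC; apply: (is_derive1_comp (f := atan)).
Qed.

Lemma integral_cauchy_le (b c : R) : 0 <= b ->
  (\int[mu]_(y in `[0%R, 1%R]) (b / (1 + (b * (y + c)) ^+ 2))%:E =
   (atan (b * (1 + c)))%:E - (atan (b * (0 + c)))%:E)%E.
Proof.
move=> b0.
have dF x := is_derive_atan_affine b c x.
have cF x : {for x, continuous (fun y => atan (b * (y + c)))}.
  apply/differentiable_continuous/derivable1_diffP.
  by have [] := dF x.
rewrite (@continuous_FTC2 _ _ (fun y => atan (b * (y + c))))//.
- apply: continuous_subspaceT => x.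
  apply: cvgM; first exact: cvg_cst.
  apply: cvgV; first by rewrite gt_eqF// ltr_wpDr ?sqr_ge0.
  apply: cvgD; first exact: cvg_cst.
  apply: (cvg_comp _ (fun x => x ^+ 2)); last exact: sqr_continuous.
  apply: cvgM; first exact: cvg_cst.
  by apply: cvgD; [exact: cvg_id|exact: cvg_cst].
- split.
  + by move=> x _; have [] := dF x.
  + by apply: cvg_at_right_filter; exact: cF.
  + by apply: cvg_at_left_filter; exact: cF.
- by move=> x _; rewrite derive1E; have [_ ->] := dF x.
Qed.


Lemma heat_kernelE t x : heat_kernel t x =
  fine (\sum_(n <oo) ((heat_term t (x - n%:R))%:E +
                      (heat_term t (x + n.+1%:R))%:E)%E).
Proof.
rewrite /heat_kernel esum_int; last by move=> k; rewrite lee_fin heat_term_ge0.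
by congr fine; apply: eq_eseriesr => n _; rewrite NegzE mulrNz opprK.
Qed.

Lemma measurable_heat_term :
  measurable_fun [set: R * R] (fun z : R * R => heat_term z.1 z.2).
Proof.
(* For t <= 0 both sides vanish: powers of 0 with a nonzero exponent are 0. *)
have -> : (fun z : R * R => heat_term z.1 z.2) =
    (fun z : R * R => (Num.max (4 * pi * z.1) 0) `^ (- 2^-1) *
      expR (- z.2 ^+ 2 * (4 * z.1) `^ (- 1))).
  apply/funext => -[t u]; rewrite /heat_term/=.
  have [t0|t0] := leP t 0.
    have ht : 4 * pi * t <= 0 by rewrite mulr_ge0_le0// mulr_ge0// pi_ge0.
    by rewrite max_r// powR0 ?ler0_sqrtr// ?invr0 ?mul0r// oppr_eq0 invr_eq0.
  have ht : 0 <= 4 * pi * t by rewrite !mulr_ge0 ?pi_ge0// ltW.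
  by rewrite max_l// inv_sqrt_powR// powR_inv1 ?mulr_ge0// ltW.
apply: measurable_funM.
  apply: (measurableT_comp (measurable_powR _)).
  by apply: measurable_maxr => //; exact: measurable_funM.
apply: (measurableT_comp (@measurable_expR R)); apply: measurable_funM.
  by apply: measurableT_comp => //; exact: measurable_funX.
apply: (measurableT_comp (measurable_powR _)).
exact: measurable_funM.
Qed.

Lemma measurable_heat_kernel d (V : measurableType d) (f g : V -> R) :
  measurable_fun setT f -> measurable_fun setT g ->
  measurable_fun setT (fun v : V => heat_kernel (f v) (g v)).
Proof.
move=> mf mg; apply: (eq_measurable_fun (fun v : V =>
  fine (\sum_(n <oo) ((heat_term (f v) (g v - n%:R))%:E +
                      (heat_term (f v) (g v + n.+1%:R))%:E)%E))).
  by move=> v _; rewrite heat_kernelE.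
have mt (h : V -> R) : measurable_fun setT h ->
    measurable_fun setT (fun v : V => (heat_term (f v) (h v))%:E).
  move=> mh; apply/measurable_EFinP.
  apply: (measurable_comp measurableT _ measurable_heat_term
    (g := fun v : V => (f v, h v))) => //.
  exact: measurable_fun_pair.
apply: (measurableT_comp (fine_measurable measurableT)).
apply: ge0_emeasurable_sum => [n v _ _|n _].
  by rewrite adde_ge0// lee_fin heat_term_ge0.
apply: emeasurable_funD; apply: mt.
  by apply: measurable_funB.
by apply: measurable_funD.
Qed.

(** The integrals over one period of the Cauchy bounds telescope along the
    lattice, so their sum is at most pi, the total variation of the arctangent. *)
Lemma heat_kernel_mass t x : torus x ->
  (\int[mu]_(y in @torus R) (heat_kernel t (x - y))%:E <= pi%:E)%E.
Proof.
move=> tx.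
have [t0|t0] := leP t 0.
  rewrite integral0_eq ?lee_fin ?pi_ge0// => y _.
  by rewrite heat_kernel_np.
have [C [C0 HC]] := heat_kernel_bounds t t0.
have mth n c : measurable_fun (@torus R) (fun y : R => (heat_term t (x - y + c))%:E).
  apply: measurable_funTS; apply/measurable_EFinP.
  apply: (measurable_comp measurableT _ measurable_heat_term
    (g := fun y : R => (t, x - y + c))) => //.
  by apply: measurable_fun_pair => //; apply: measurable_funD => //; apply: measurable_funB.
have mtorus : measurable (@torus R) by exact: measurable_itv.
rewrite [leLHS](_ : _ = \int[mu]_(y in @torus R) \sum_(n <oo)
  ((heat_term t (x - y - n%:R))%:E + (heat_term t (x - y + n.+1%:R))%:E))%E; last first.
  apply: eq_integral.
  move=> y; rewrite inE => ty.
  have xy2 : `|x - y| <= 2.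
    move: tx ty; rewrite /torus /= !in_itv/= => /andP[? ?] /andP[? ?].
    by rewrite ler_norml; lra.
  have tt : 0 < t <= t by rewrite t0 lexx.
  have [-> _ _] := HC t (x - y) tt xy2.
  rewrite esum_int; last by move=> k; rewrite lee_fin heat_term_ge0.
  by apply: eq_eseriesr => n _; rewrite NegzE mulrNz opprK.
rewrite integral_nneseries//; first last.
- by move=> n y _; rewrite adde_ge0// lee_fin heat_term_ge0.
- by move=> n; apply: emeasurable_funD; apply: mth.
set b : R := (Num.sqrt (4 * t))^-1.
have b0 : 0 <= b by rewrite invr_ge0 sqrtr_ge0.
have one c : (\int[mu]_(y in @torus R) (heat_term t (x - y + c))%:E <=
    (atan (b * (1 - x - c)) - atan (b * (- x - c)))%:E)%E.
  apply: (@le_trans _ _ (\int[mu]_(y in `[0%R, 1%R])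
      (b / (1 + (b * (y + (- x - c))) ^+ 2))%:E)%E); last first.
    by rewrite integral_cauchy_le// -EFinB add0r addrA.
  have mc : measurable_fun setT (fun y : R => (b / (1 + (b * (y + (- x - c))) ^+ 2))%:E).
    apply/measurable_EFinP; apply: continuous_measurable_fun => y.
    apply: cvgM; first exact: cvg_cst.
    apply: cvgV; first by rewrite gt_eqF// ltr_wpDr ?sqr_ge0.
    apply: cvgD; first exact: cvg_cst.
    apply: (cvg_comp _ (fun x => x ^+ 2)); last exact: sqr_continuous.
    apply: cvgM; first exact: cvg_cst.
    by apply: cvgD; [exact: cvg_id|exact: cvg_cst].
  apply: (@le_trans _ _ (\int[mu]_(y in @torus R)
      (b / (1 + (b * (y + (- x - c))) ^+ 2))%:E)%E).
    apply: ge0_le_integral => //.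
    + by move=> y _; rewrite lee_fin heat_term_ge0.
    + exact: mth.
    + exact: measurable_funTS.
    + move=> y _; rewrite lee_fin (le_trans (heat_term_le_cauchy _ _ t0))// -/b.
      rewrite (_ : (b * (x - y + c)) ^+ 2 = (b * (y + (- x - c))) ^+ 2)//; ring.
  apply: ge0_subset_integral => //.
  - exact: measurable_funTS.
  - by move=> y _; rewrite lee_fin divr_ge0// addr_ge0// sqr_ge0.
  - by apply: subset_itvl; rewrite bnd_simp.
apply: nneseries_le_partial => n.
  by apply: integral_ge0 => y _; rewrite adde_ge0// lee_fin heat_term_ge0.
pose H (k : R) := atan (b * (k - x)).
apply: (@le_trans _ _ (\sum_(0 <= i < n)
   ((H (i.+1%:R) - H i%:R) + (H (- i%:R) - H (- (i.+1%:R))))%:E)%E).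
  apply: lee_sum => i _; rewrite ge0_integralD//; first last.
  - exact: mth.
  - by move=> y _; rewrite lee_fin heat_term_ge0.
  - exact: mth.
  - by move=> y _; rewrite lee_fin heat_term_ge0.
  rewrite EFinD; apply: leeD.
    apply: (le_trans (one (- i%:R))); rewrite lee_fin /H -(natr1 i).
    by rewrite le_eqVlt; apply/orP; left; apply/eqP; congr (atan _ - atan _); ring.
  apply: (le_trans (one (i.+1%:R))); rewrite lee_fin /H -(natr1 i).
  by rewrite le_eqVlt; apply/orP; left; apply/eqP; congr (atan _ - atan _); ring.
rewrite sumEFin lee_fin big_split/= (telescope_sumr (fun i => H i%:R))//.
rewrite (telescope_sumr_eq (fun i => - H (- i%:R)))//; last first.
  by move=> k _; rewrite opprK addrC.
rewrite oppr0 opprK; have := atan_ltpi2 (b * (n%:R - x)).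
have := atan_gtNpi2 (b * (- n%:R - x)); rewrite /H; lra.
Qed.
End heat_mass.

(** * An integrable singularity in time *)

Section time_singularity.
Context {R : realType}.
Local Notation mu := lebesgue_measure.

Lemma is_derive_powR_sub (t c s : R) : s < t ->
  is_derive s 1 (fun s => (t - s) `^ c) (- (c * (t - s) `^ (c - 1))).
Proof.
move=> st; have h : is_derive s 1 (fun s : R => t - s) (-1).
  by rewrite -(add0r (-1)); apply: is_deriveB.
have hp : is_derive (t - s) 1 (@powR R ^~ c) (c * (t - s) `^ (c - 1)).
  by apply: is_derive1_powR; rewrite subr_gt0.
rewrite -(mulrN1 (c * _)); exact: (is_derive1_comp (f := @powR R ^~ c)).
Qed.

(** On [0, t - t / (n + 2)] the integrand is smooth and its primitive is bounded
    independently of n; monotone convergence does the rest. *)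
Lemma integral_powR_sub_lty (t a : R) : 0 <= t -> 0 <= a < 1 ->
  (\int[mu]_(s in `[0%R, t]) ((t - s) `^ (- a))%:E < +oo)%E.
Proof.
move=> + /andP[a0 a1]; rewrite le_eqVlt => /predU1P[<-|t0].
  by rewrite set_itv1 integral_set1 ltry.
have mf (D : set R) : measurable_fun D (fun s : R => ((t - s) `^ (- a))%:E).
  apply: measurable_funTS; apply/measurable_EFinP.
  apply: (measurableT_comp (measurable_powR _)).
  exact: measurable_funB.
rewrite -integral_itv_bndo_bndc//.
(* n + 2 rather than n + 1, so that the interval [0, b 0] is not reduced to 0. *)
pose b (n : nat) := t - t / n.+2%:R.
have bt n : b n < t by rewrite ltrBlDr ltrDl divr_gt0.
have b0 n : 0 < b n.
  by rewrite subr_gt0 ltr_pdivrMr// ltr_pMr// ltr1n.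
have part n : (\int[mu]_(s in `[0%R, b n]) ((t - s) `^ (- a))%:E <=
    (t `^ (1 - a) / (1 - a))%:E)%E.
  have dF s : s < t -> is_derive s 1 (fun s => (- (1 - a)^-1) * (t - s) `^ (1 - a))
      ((t - s) `^ (- a)).
    move=> st; have := is_derive_powR_sub t (1 - a) s st => ?.
    apply: is_derive_eq; rewrite /GRing.scale/= (_ : 1 - a - 1 = - a); last by ring.
    by field; lra.
  have cF s : s < t ->
      {for s, continuous (fun s => (- (1 - a)^-1) * (t - s) `^ (1 - a))}.
    move=> st; apply/differentiable_continuous/derivable1_diffP.
    by have [] := dF s st.
  rewrite (@continuous_FTC2 _ _ (fun s => (- (1 - a)^-1) * (t - s) `^ (1 - a)))//.
  - rewrite -EFinB lee_fin subr0 mulNr mulNr opprK [leRHS]mulrC gerDr oppr_le0.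
    by rewrite mulr_ge0 ?powR_ge0// invr_ge0; lra.
  - apply: derivable_within_continuous => s; rewrite in_itv/= => /andP[_ sb].
    by have [] := is_derive_powR_sub t (- a) s (le_lt_trans sb (bt n)).
  - split.
    + move=> s; rewrite in_itv/= => /andP[_ sb].
      by have [] := dF s (lt_trans sb (bt n)).
    + by apply: cvg_at_right_filter; exact: cF.
    + by apply: cvg_at_left_filter; exact: cF.
  - move=> s; rewrite in_itv/= => /andP[_ sb]; rewrite derive1E.
    by have [_ ->] := dF s (lt_trans sb (bt n)).
have -> : `[0%R, t[%classic = \bigcup_n `[0%R, b n]%classic.
  apply/seteqP; split => [s|s [n _]] /=; rewrite !in_itv/=; last first.
    by move=> /andP[-> sb]; exact: le_lt_trans sb (bt n).
  move=> /andP[s0 st]; exists (Num.truncn (t / (t - s))) => //=.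
  rewrite in_itv/= s0/= lerBrDr -lerBrDl ler_pdivrMr// mulrC -ler_pdivrMr ?subr_gt0//.
  apply: (le_trans (ltW (truncnS_gt _))).
  by rewrite ler_nat.
apply: (@le_lt_trans _ _ ((t `^ (1 - a) / (1 - a))%:E)); last exact: ltry.
have ndb : nondecreasing_seq (fun n => `[0%R, b n]%classic).
  move=> m n mn; apply/subsetPset/subset_itvl; rewrite bnd_simp /b.
  rewrite lerD2l lerN2 ler_wpM2l ?(ltW t0)// lef_pV2 ?posrE ?ltr0n//.
  by rewrite ler_nat !ltnS.
have /cvg_lim <- // : (\int[mu]_(s in `[0%R, b n]) ((t - s) `^ (- a))%:E)%E @[n --> \oo] -->
    (\int[mu]_(s in \bigcup_n `[0%R, b n]%classic) ((t - s) `^ (- a))%:E)%E.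
  apply: ge0_nondecreasing_set_cvg_integral => //.
    by move=> n; exact: mf.
  by move=> n s _; rewrite lee_fin powR_ge0.
apply: lime_le.
  apply: ereal_nondecreasing_is_cvgn.
  apply: ge0_nondecreasing_set_nondecreasing_integral => //.
    by move=> n; exact: mf.
  by move=> n s _; rewrite lee_fin powR_ge0.
by apply: nearW => n; exact: part.
Qed.

End time_singularity.

(** * Parametric and iterated integrals *)

Section parametric_integral.
Context {d1 d2 : measure_display} {T1 : measurableType d1} {T2 : measurableType d2}
  {R : realType}.

Lemma measurable_fun_ge0_integral (m2 : {sigma_finite_measure set T2 -> \bar R})
    (D : set T2) (f : T1 * T2 -> \bar R) :
  measurable D -> measurable_fun setT f -> (forall z, 0 <= f z)%E ->
  measurable_fun setT (fun x => \int[m2]_(y in D) f (x, y))%E.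
Proof.
move=> mD mf f0.
pose g := f \_ ([set: T1] `*` D).
have -> : (fun x => \int[m2]_(y in D) f (x, y))%E =
    (fun x => \int[m2]_y g (x, y))%E.
  apply/funext => x; rewrite integral_mkcond; apply: eq_integral => y _.
  by rewrite /g !patchE; congr (if _ then _ else _); apply/idP/idP; rewrite !inE => // -[].
apply: (measurable_fun_fubini_tonelli_F g).
  have mTD : measurable ([set: T1] `*` D) by exact: measurableX.
  by apply/(measurable_restrictT f mTD); exact: measurable_funTS.
by move=> z; apply: erestrict_ge0 => {}z _; exact: f0.
Qed.

Lemma measurable_fun_Rintegral (m2 : {sigma_finite_measure set T2 -> \bar R})
    (D : set T2) (f : T1 * T2 -> R) :
  measurable D -> measurable_fun setT f ->
  measurable_fun setT (fun x => \int[m2]_(y in D) f (x, y)).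
Proof.
move=> mD mf; apply: (measurableT_comp (fine_measurable measurableT)).
have -> : (fun x => \int[m2]_(y in D) (f (x, y))%:E)%E =
  (fun x => (\int[m2]_(y in D) (EFin \o f)^\+ (x, y))%E -
            (\int[m2]_(y in D) (EFin \o f)^\- (x, y))%E)%E.
  by apply/funext => x; rewrite integralE; congr (_ - _)%E; apply: eq_integral => y _; rewrite ?funeposE ?funenegE.
have mEf : measurable_fun setT (EFin \o f) by exact/measurable_EFinP.
apply: emeasurable_funB; apply: measurable_fun_ge0_integral => //.
- exact: measurable_funepos.
- exact: measurable_funeneg.
Qed.

End parametric_integral.

Section iterated_integral.
Context {d1 d2 : measure_display} {T1 : measurableType d1} {T2 : measurableType d2}
  {R : realType}.
Variables (m1 : {sigma_finite_measure set T1 -> \bar R})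
  (m2 : {sigma_finite_measure set T2 -> \bar R}).
Variables (D : set T1) (E : set T2).
Hypotheses (mD : measurable D) (mE : measurable E).

(** The sections of q1 f and q2 f are integrable only for those s where the
    weighted section of f is. The other s carry meaningless inner integrals, but
    they form a null set since the iterated weighted integral is finite. *)
Lemma iterated_Rintegral_dist_le (f q1 q2 : T1 * T2 -> R) (k : T1 -> R) (C e : R) :
  measurable_fun setT f -> measurable_fun setT q1 -> measurable_fun setT q2 ->
  measurable_fun setT k -> (forall s, 0 <= k s) -> 0 <= C -> 0 <= e ->
  (forall s y, D s -> E y -> `|q1 (s, y)| <= C * k s) ->
  (forall s y, D s -> E y -> `|q2 (s, y)| <= C * k s) ->
  (forall s y, D s -> E y -> `|q1 (s, y) - q2 (s, y)| <= e * k s) ->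
  (\int[m1]_(s in D) \int[m2]_(y in E) (k s * `|f (s, y)|)%:E < +oo)%E ->
  `|\int[m1]_(s in D) \int[m2]_(y in E) (q1 (s, y) * f (s, y)) -
    \int[m1]_(s in D) \int[m2]_(y in E) (q2 (s, y) * f (s, y))| <=
  e * fine (\int[m1]_(s in D) \int[m2]_(y in E) (k s * `|f (s, y)|)%:E)%E.
Proof.
move=> mf mq1 mq2 mk k0 C0 e0 q1k q2k q12 Kfin.
pose h (z : T1 * T2) := k z.1 * `|f z|.
have mh : measurable_fun setT h.
  apply: measurable_funM; last exact: measurableT_comp.
  exact: measurableT_comp.
have h0 z : 0 <= h z by rewrite mulr_ge0.
pose G s := (\int[m2]_(y in E) (h (s, y))%:E)%E.
have mG : measurable_fun setT G.
  apply: (measurable_fun_ge0_integral m2 E (EFin \o h)) => //.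
    exact/measurable_EFinP.
have G0 s : (0 <= G s)%E by apply: integral_ge0 => y _; rewrite lee_fin.
have iG : m1.-integrable D G.
  apply/integrableP; split; first exact: measurable_funTS.
  by under eq_integral do rewrite gee0_abs//.
have IG0 : (0 <= \int[m1]_(s in D) G s)%E by exact: integral_ge0.
have IGfin : (\int[m1]_(s in D) G s)%E \is a fin_num by rewrite ge0_fin_numE.
have aeG := integrable_ae mD iG.
have msec (g : T1 * T2 -> R) s : measurable_fun setT g ->
    measurable_fun E (fun y => g (s, y)).
  move=> mg; apply: measurable_funTS; exact: measurableT_comp.
have bound (q : T1 * T2 -> R) (c : R) s : measurable_fun setT q -> D s -> 0 <= c ->
    (forall y, E y -> `|q (s, y)| <= c * k s) -> G s \is a fin_num ->
    m2.-integrable E (EFin \o (fun y => q (s, y) * f (s, y))) /\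
    (`|\int[m2]_(y in E) (q (s, y) * f (s, y))|%:E <= c%:E * G s)%E.
  move=> mq Ds c0 qk Gfin.
  have mqf : measurable_fun E (fun y => q (s, y) * f (s, y)).
    by apply: (msec (q \* f)); exact: measurable_funM.
  have le : (\int[m2]_(y in E) `|(q (s, y) * f (s, y))%:E| <= c%:E * G s)%E.
    rewrite -ge0_integralZl//; last 2 first.
      by apply/measurable_EFinP; exact: msec.
      by move=> y _; rewrite lee_fin.
    apply: ge0_le_integral => //.
    - by apply: measurableT_comp => //; exact/measurable_EFinP.
    - apply: measurable_funeM; apply/measurable_EFinP; exact: msec.
    - move=> y Ey; rewrite /= -EFinM lee_fin normrM /h mulrA ler_wpM2r//; exact: qk.
  have iqf : m2.-integrable E (EFin \o (fun y => q (s, y) * f (s, y))).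
    apply/integrableP; split; first exact/measurable_EFinP.
    apply: (le_lt_trans le); rewrite ltey_eq fin_numM//.
  split=> //; apply: le_trans le.
  by rewrite EFin_normr_Rintegral// le_abse_integral//; exact/measurable_EFinP.
pose I (q : T1 * T2 -> R) s := \int[m2]_(y in E) (q (s, y) * f (s, y)).
have mI (q : T1 * T2 -> R) : measurable_fun setT q -> measurable_fun setT (I q).
  move=> mq; apply: (measurable_fun_Rintegral m2 E (q \* f)) => //.
  exact: measurable_funM.
have iI (q : T1 * T2 -> R) : measurable_fun setT q ->
    (forall s y, D s -> E y -> `|q (s, y)| <= C * k s) ->
    m1.-integrable D (EFin \o I q).
  move=> mq qk; apply/integrableP; split.
    by apply: measurable_funTS; apply/measurable_EFinP; exact: mI.
  apply: (@le_lt_trans _ _ (\int[m1]_(s in D) (C%:E * G s))%E).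
    apply: ae_ge0_le_integral => //.
    - by apply: measurable_funTS; apply: measurableT_comp => //;
        apply/measurable_EFinP; exact: mI.
    - by move=> s _; rewrite mule_ge0.
    - by apply: measurable_funTS; exact: measurable_funeM.
    - apply: filterS aeG => s Gs Ds.
      by have [_] := bound q C s mq Ds C0 (fun y => qk s y Ds) (Gs Ds).
  rewrite ge0_integralZl//; last exact: measurable_funTS.
  by rewrite ltey_eq fin_numM.
rewrite [X in _ <= e * fine X](_ : _ = (\int[m1]_(s in D) G s)%E)//.
rewrite -/(I q1) -/(I q2) -RintegralB//; [|exact: iI..].
have iI12 : m1.-integrable D (EFin \o (fun s => I q1 s - I q2 s)).
  rewrite (_ : _ \o _ = (EFin \o I q1) \- (EFin \o I q2))%E//.
  by apply: integrableB => //; exact: iI.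
rewrite -lee_fin EFin_normr_Rintegral//.
apply: (le_trans (le_abse_integral _ mD _)).
  by apply: measurable_int iI12.
rewrite EFinM fineK//.
rewrite -ge0_integralZl//; last 1 first.
  exact: measurable_funTS.
apply: ae_ge0_le_integral => //.
- by apply: measurableT_comp => //; apply: measurable_int iI12.
- by move=> s _; rewrite mule_ge0.
- by apply: measurable_funTS; exact: measurable_funeM.
- apply: filterS aeG => s Gs Ds.
  have [i1 _] := bound q1 C s mq1 Ds C0 (fun y => q1k s y Ds) (Gs Ds).
  have [i2 _] := bound q2 C s mq2 Ds C0 (fun y => q2k s y Ds) (Gs Ds).
  have mq12 : measurable_fun setT (q1 \- q2) by exact: measurable_funB.
  have [_] := bound (q1 \- q2) e s mq12 Ds e0 (fun y => q12 s y Ds) (Gs Ds).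
  rewrite /= /I -RintegralB//; apply: le_trans.
  rewrite lee_fin le_eqVlt; apply/orP; left; apply/eqP; congr `|_|.
  by apply: eq_Rintegral => y _; rewrite mulrBl.
Qed.

End iterated_integral.

Section swap.
Context {d1 d2 : measure_display} {T1 : measurableType d1} {T2 : measurableType d2}
  {R : realType}.
Variables (m1 : {sigma_finite_measure set T1 -> \bar R})
  (m2 : {sigma_finite_measure set T2 -> \bar R}).

Lemma fubini_tonelli_set (D : set T2) (f : T1 * T2 -> \bar R) :
  measurable D -> measurable_fun setT f -> (forall z, 0 <= f z)%E ->
  (\int[m1]_x \int[m2]_(y in D) f (x, y) = \int[m2]_(y in D) \int[m1]_x f (x, y))%E.
Proof.
move=> mD mf f0.
pose g := f \_ ([set: T1] `*` D).
have mTD : measurable ([set: T1] `*` D) by exact: measurableX.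
have mg : measurable_fun setT g.
  by apply/(measurable_restrictT f mTD); exact: measurable_funTS.
have g0 z : (0 <= g z)%E by apply: erestrict_ge0 => {}z _; exact: f0.
have gE x y : g (x, y) = if y \in D then f (x, y) else 0%E.
  by rewrite /g patchE; congr (if _ then _ else _); apply/idP/idP; rewrite !inE => // -[].
transitivity (\int[m1]_x \int[m2]_y g (x, y))%E.
  apply: eq_integral => x _; rewrite integral_mkcond; apply: eq_integral => y _.
  by rewrite gE patchE.
rewrite fubini_tonelli// [RHS]integral_mkcond; apply: eq_integral => y _.
rewrite patchE; case: ifPn => yD.
  by apply: eq_integral => x _; rewrite gE yD.
by rewrite integral0_eq// => x _; rewrite gE (negbTE yD).
Qed.

End swap.

(** * The flat torus *)

Section torus.
Context {R : realType}.

Lemma measurable_torus : measurable (@torus R).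
Proof. exact: measurable_itv. Qed.

Lemma lebesgue_torus : (lebesgue_measure (@torus R) = 1)%E.
Proof. by rewrite /torus lebesgue_measure_itv/= lte_fin ltr01 -EFinB subr0. Qed.

Lemma torus_dist_ge0 (x y : R) : torus x -> torus y -> 0 <= torus_dist x y.
Proof.
rewrite /torus /= !in_itv/= => /andP[? ?] /andP[? ?].
by rewrite le_min normr_ge0 subr_ge0 ler_norml; lra.
Qed.

Lemma torus_dist_le1 (x y : R) : torus x -> torus y -> torus_dist x y <= 1.
Proof.
rewrite /torus /= !in_itv/= => /andP[? ?] /andP[? ?].
by rewrite ge_min ler_norml; apply/orP; left; lra.
Qed.

Lemma torus_dist_eq0 (x y : R) : torus x -> torus y -> torus_dist x y = 0 -> x = y.
Proof.
rewrite /torus /= !in_itv/= => /andP[x0 x1] /andP[y0 y1].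
rewrite /torus_dist /Num.min; case: ifP => _.
  by move/normr0_eq0/subr0_eq.
have : `|x - y| < 1 by rewrite ltr_norml; lra.
by rewrite -subr_gt0 => /[swap] ->; rewrite ltxx.
Qed.

Lemma torus_holder_le (d1 d2 : R) (g : R -> R) : 0 < d1 <= d2 ->
  torus_holder d2 g -> torus_holder d1 g.
Proof.
move=> /andP[d10 d12] [C HC]; exists `|C| => x y tx ty.
apply: (le_trans (HC x y tx ty)).
apply: (@le_trans _ _ (`|C| * torus_dist x y `^ d2)).
  by apply: ler_wpM2r; rewrite ?powR_ge0 ?ler_norm.
apply: ler_wpM2l => //.
have := torus_dist_ge0 x y tx ty; rewrite le_eqVlt => /predU1P[<-|xy0].
  by rewrite !powR0 ?gt_eqF// (lt_le_trans d10).
by apply: ger_powR => //; rewrite xy0 torus_dist_le1.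
Qed.

End torus.

(** * Spatial regularity of the drift part *)

Section drift.
Context {d : measure_display} {Omega : measurableType d} {R : realType}.
Variable P : probability Omega R.
Local Notation mu := lebesgue_measure.

Lemma reaction_le (v : R) : `|reaction v| <= 1 + 2 * `|v| `^ 3.
Proof.
rewrite /reaction (powR_mulrn 3)//.
apply: (le_trans (ler_normB _ _)); rewrite normrX.
have a0 := normr_ge0 v; move: a0; set a := `|v| => a0.
have [a1|a1] := leP a 1; first by have := exprn_ge0 3 a0; lra.
have : a <= a ^+ 3 by rewrite -[leLHS]expr1 ler_eXn2l.
lra.
Qed.

Variables (T : R) (u : R -> R -> Omega -> R).
Hypothesis T0 : 0 < T.
Hypothesis hu_meas : measurable_fun (spacetime T `*` [set: Omega])
        (fun z : (R * R) * Omega => u z.1.1 z.1.2 z.2).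
Hypothesis hmom : bounded_moments P T u.

(** The field is measurable on the time slab only; it is extended by 0. *)
Let U := (fun z : (R * R) * Omega => u z.1.1 z.1.2 z.2) \_
           (spacetime T `*` [set: Omega]).

Let mST : measurable (spacetime T).
Proof. by apply: measurableX; exact: measurable_itv. Qed.

Let mU : measurable_fun setT U.
Proof.
have mSTO : measurable (spacetime T `*` [set: Omega]) by exact: measurableX.
by apply/(measurable_restrictT _ mSTO).
Qed.

Let UE s y w : 0 <= s <= T -> torus y -> U ((s, y), w) = u s y w.
Proof.
move=> sT ty; rewrite /U patchE mem_set//; split => //; split => //=.
Qed.

Let f (w : Omega) (z : R * R) := reaction (U (z, w)).

Let measurable_reaction d' (V : measurableType d') (g : V -> R) :
  measurable_fun setT g -> measurable_fun setT (fun v => reaction (g v)).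
Proof.
by move=> mg; apply: measurable_funB => //; exact: measurable_funX.
Qed.

Let mf w : measurable_fun setT (f w).
Proof.
apply: measurable_reaction; apply: (measurableT_comp mU).
exact: measurable_fun_pair.
Qed.

Let driftE t x w : 0 <= t <= T -> drift_part u t x w =
  \int[mu]_(s in `[0%R, t]) \int[mu]_(y in @torus R)
     (heat_kernel (t - s) (x - y) * f w (s, y)).
Proof.
move=> /andP[t0 tT]; apply: eq_Rintegral => s; rewrite inE/= in_itv/= => /andP[s0 st].
apply: eq_Rintegral => y; rewrite inE => ty; rewrite /f UE//.
by rewrite s0 (le_trans st).
Qed.

Lemma measurable_drift_part t x : 0 <= t <= T ->
  measurable_fun setT (drift_part u t x).
Proof.
move=> tT.
rewrite (_ : drift_part u t x = fun w => \int[mu]_(s in `[0%R, t]) \int[mu]_(y in @torus R)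
     (heat_kernel (t - s) (x - y) * f w (s, y))); last first.
  by apply/funext => w; rewrite driftE.
pose Phi (z : (Omega * R) * R) := heat_kernel (t - z.1.2) (x - z.2) *
   reaction (U ((z.1.2, z.2), z.1.1)).
have mPhi : measurable_fun setT Phi.
  apply: measurable_funM.
    apply: measurable_heat_kernel; apply: measurable_funB => //.
    exact: measurableT_comp.
  apply: measurable_reaction; apply: (measurableT_comp mU).
  apply: measurable_fun_pair; last exact: measurableT_comp.
  by apply: measurable_fun_pair => //; exact: measurableT_comp.
have mI : measurable_fun setT (fun z : Omega * R => \int[mu]_(y in @torus R) Phi (z, y)).
  exact: (measurable_fun_Rintegral mu (@torus R) Phi measurable_torus).
exact: (measurable_fun_Rintegral mu `[0%R, t]%classic _ (measurable_itv _) mI).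
Qed.

(** The reaction term is cubic, so third moments suffice. *)
Let moment : exists M : R, 0 <= M /\ forall s y, 0 <= s <= T -> torus y ->
  (\int[P]_w (`|f w (s, y)|)%:E <= M%:E)%E.
Proof.
have := hmom 3 ltac:(lra).
set S := ereal_sup _ => Sfin.
have S0 : (0 <= S)%E.
  apply: (@le_trans _ _ ('E_P[fun w => (`|u 0 0 w| `^ 3)%R])%E).
    by apply: expectation_ge0 => w; exact: powR_ge0.
  apply: ereal_sup_ubound; exists (0, 0) => //.
  by split; rewrite /torus /= in_itv/= lexx ?(ltW T0) ?ltr01.
exists (1 + 2 * fine S); split; first by rewrite addr_ge0// mulr_ge0// fine_ge0.
move=> s y sT ty.
have mUw : measurable_fun setT (fun w => U ((s, y), w)).
  by apply: (measurableT_comp mU); exact: measurable_fun_pair.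
have mp : measurable_fun setT (fun w => `|U ((s, y), w)| `^ 3).
  by apply: (measurableT_comp (measurable_powR _)); exact: measurableT_comp.
apply: (@le_trans _ _ (\int[P]_w (1 + 2%:E * (`|U ((s, y), w)| `^ 3)%:E))%E).
  apply: ge0_le_integral => //.
  - apply/measurable_EFinP; apply: measurableT_comp => //.
    exact: measurable_reaction.
  - apply: emeasurable_funD => //; apply: measurable_funeM; exact/measurable_EFinP.
  - by move=> w _; rewrite -EFinM -EFinD lee_fin; exact: reaction_le.
rewrite ge0_integralD//; last by apply: measurable_funeM; exact/measurable_EFinP.
rewrite integral_cst// mul1e.
rewrite [X in (X + _ <= _)%E](_ : _ = 1%E); last exact: probability_setT.
rewrite ge0_integralZl//; last exact/measurable_EFinP.
have -> : (1 + 2 * fine S)%:E = (1 + 2%:E * S)%E.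
  by rewrite -[in RHS](@fineK _ S) ?ge0_fin_numE.
apply: leeD => //; apply: lee_wpmul2l; first by rewrite lee_fin.
apply: ereal_sup_ubound; exists (s, y); first by split => //=; rewrite in_itv.
by rewrite unlock; apply: eq_integral => w _; rewrite UE.
Qed.

(** The expectation of this integral is, by Tonelli's theorem, at most
    M int_0^t (t - s)^(-a) ds. *)
Let weighted_reaction_finite (t a : R) : 0 <= t <= T -> 0 <= a < 1 ->
  {ae P, forall w, (\int[mu]_(s in `[0%R, t]) \int[mu]_(y in @torus R)
     ((t - s) `^ (- a) * `|f w (s, y)|)%:E < +oo)%E}.
Proof.
move=> tT a01.
have /andP[t0 tT'] := tT.
pose H (z : (Omega * R) * R) := ((t - z.1.2) `^ (- a) * `|f z.1.1 (z.1.2, z.2)|)%:E.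
have mH : measurable_fun setT H.
  apply/measurable_EFinP/measurable_funM.
    apply: (measurableT_comp (measurable_powR _)); apply: measurable_funB => //.
    exact: measurableT_comp.
  apply: measurableT_comp => //; apply: measurable_reaction; apply: (measurableT_comp mU).
  apply: measurable_fun_pair; last exact: measurableT_comp.
  by apply: measurable_fun_pair => //; exact: measurableT_comp.
have H0 z : (0 <= H z)%E by rewrite lee_fin mulr_ge0 ?powR_ge0.
have mtorus := @measurable_torus R.
pose G (z : Omega * R) := (\int[mu]_(y in @torus R) H (z, y))%E.
have mG : measurable_fun setT G by exact: (measurable_fun_ge0_integral mu (@torus R) H).
have G0 z : (0 <= G z)%E by exact: integral_ge0.
have [M [M0 HM]] := moment.
have IK : (\int[P]_w \int[mu]_(s in `[0%R, t]) G (w, s) < +oo)%E.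
  rewrite (fubini_tonelli_set P mu `[0%R, t]%classic G)//.
  have mw : measurable_fun setT (fun s : R => ((t - s) `^ (- a))%:E).
    apply/measurable_EFinP; apply: (measurableT_comp (measurable_powR _)).
    exact: measurable_funB.
  apply: (@le_lt_trans _ _ (\int[mu]_(s in `[0%R, t]) (M%:E * ((t - s) `^ (- a))%:E))%E).
    apply: ge0_le_integral => //.
    - by move=> s _; exact: integral_ge0.
    - apply: measurable_funTS.
      exact: (measurable_fun_fubini_tonelli_G G).
    - by apply: measurable_funTS; exact: measurable_funeM.
    - move=> s; rewrite /= in_itv/= => /andP[s0 st].
      have sT : 0 <= s <= T by rewrite s0 (le_trans st).
      rewrite (fubini_tonelli_set P mu (@torus R) (fun z : Omega * R => H ((z.1, s), z.2)))//; last first.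
        apply: (measurableT_comp mH); apply: measurable_fun_pair => //.
        exact: measurable_fun_pair.
      apply: (@le_trans _ _ (\int[mu]_(y in @torus R) (M%:E * ((t - s) `^ (- a))%:E))%E).
        apply: ge0_le_integral => //.
        + by move=> y _; exact: integral_ge0.
        + apply: measurable_funTS.
          apply: (measurable_fun_fubini_tonelli_G (fun z : Omega * R => H ((z.1, s), z.2))) => //.
          apply: (measurableT_comp mH); apply: measurable_fun_pair => //.
          exact: measurable_fun_pair.
        + move=> y ty; rewrite /H/=.
          under eq_integral do rewrite EFinM.
          rewrite ge0_integralZl ?lee_fin ?powR_ge0//; last first.
            apply/measurable_EFinP; apply: measurableT_comp => //.
            by apply: measurable_reaction; apply: (measurableT_comp mU); exact: measurable_fun_pair.
          by rewrite muleC; apply: lee_wpmul2r; [rewrite lee_fin powR_ge0|exact: HM].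
      rewrite integral_cst//= lebesgue_torus mule1//.
  rewrite ge0_integralZl//; last 2 first.
    exact: measurable_funTS.
    by move=> s _; rewrite lee_fin powR_ge0.
  by apply: lte_mul_pinfty => //; exact: integral_powR_sub_lty.
have iK : P.-integrable setT (fun w => \int[mu]_(s in `[0%R, t]) G (w, s))%E.
  apply/integrableP; split.
    exact: (measurable_fun_ge0_integral mu `[0%R, t]%classic G).
  by under eq_integral do rewrite gee0_abs ?integral_ge0//.
apply: filterS (integrable_ae measurableT iK) => w /(_ I).
rewrite ge0_fin_numE//; first exact: integral_ge0.
Qed.

(** The weight (t - s)^(-a) with a = (1 + delta) / 2 < 1 dominates the kernel and
    its increments of order delta; the weighted integral of the reaction term
    is the random Hoelder constant. *)
Lemma drift_part_as_holder (delta t : R) : 0 < delta < 1 -> 0 <= t <= T ->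
  as_holder_below P delta (drift_part u t).
Proof.
move=> /andP[d0 d1] tT; exists (drift_part u t).
  move=> x tx; split; first exact: measurable_drift_part.
  exact: aeW.
have /andP[t0 tT'] := tT.
pose a := (1 + delta) / 2.
have a01 : 0 <= a < 1 by rewrite /a; lra.
have d01 : 0 < delta <= 1 by rewrite d0 ltW.
have [C1 [C10 HC1]] := heat_kernel_torus_holder T delta T0 d01.
have a2 : 2^-1 <= a by rewrite /a; lra.
have [C2 [C20 HC2]] := heat_kernel_torus_le T a T0 a2.
apply: filterS (weighted_reaction_finite t a tT a01) => w Kfin delta' /andP[d'0 d'd].
apply: (torus_holder_le delta' delta); first by rewrite d'0 ltW.
exists (C1 * fine (\int[mu]_(s in `[0%R, t]) \int[mu]_(y in @torus R)
     ((t - s) `^ (- a) * `|f w (s, y)|)%:E)%E) => x y tx ty.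
rewrite !driftE// mulrAC.
have mhk x' : measurable_fun setT (fun z : R * R => heat_kernel (t - z.1) (x' - z.2)).
  by apply: measurable_heat_kernel; exact: measurable_funB.
have hk_le x' s z : torus x' -> `[0%R, t]%classic s -> torus z ->
    `|heat_kernel (t - s) (x' - z)| <= C2 * (t - s) `^ (- a).
  move=> tx'; rewrite /= in_itv/= => /andP[s0 st] tz.
  rewrite ger0_norm ?heat_kernel_ge0//; apply: HC2 => //.
  by rewrite lerBlDr (le_trans tT')// lerDl.
have mk : measurable_fun setT (fun s : R => (t - s) `^ (- a)).
  by apply: (measurableT_comp (measurable_powR _)); exact: measurable_funB.
apply: (iterated_Rintegral_dist_le mu mu `[0%R, t]%classic (@torus R) _ _
  (f w) (fun z => heat_kernel (t - z.1) (x - z.2))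
  (fun z => heat_kernel (t - z.1) (y - z.2)) (fun s => (t - s) `^ (- a)) C2
  (C1 * torus_dist x y `^ delta)) => //.
- exact: measurable_torus.
- exact: mf.
- exact: mhk.
- exact: mhk.
- by move=> s; exact: powR_ge0.
- by rewrite mulr_ge0 ?powR_ge0.
- by move=> s z Ds Ez; exact: hk_le.
- by move=> s z Ds Ez; exact: hk_le.
- move=> s z /=; rewrite in_itv/= => /andP[s0 st] tz; rewrite mulrAC; apply: HC1 => //.
  by rewrite lerBlDr (le_trans tT')// lerDl.
Qed.

End drift.

(** * Tails of Gaussian variables *)

Section gaussian.
Context {R : realType}.
Local Notation mu := lebesgue_measure.

(** The interval of length |s| around 0 carries at most half of the mass. *)
Lemma normal_peak_le (s : R) : s != 0 -> normal_peak s * `|s| <= 2^-1.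
Proof.
move=> s0; have s2 : 0 < s ^+ 2 by rewrite exprn_even_gt0.
have Q0 : 0 < Num.sqrt (s ^+ 2 * pi *+ 2).
  by rewrite sqrtr_gt0 pmulrn_lgt0// mulr_gt0// pi_gt0.
rewrite /normal_peak mulrC ler_pdivrMr//.
suff : 2 * `|s| <= Num.sqrt (s ^+ 2 * pi *+ 2) by lra.
rewrite -[leLHS]ger0_norm ?mulr_ge0// -sqrtr_sqr ler_wsqrtr//.
rewrite exprMn real_normK ?num_real// -mulr_natr.
by have := @pi_ge2 R; nra.
Qed.

Lemma measurable_abs_gt (l : R) : measurable [set x : R | l < `|x|].
Proof.
rewrite (_ : mkset _ = (fun x : R => `|x|) @^-1` `]l, +oo[%classic); last first.
  by apply/seteqP; split => x /=; rewrite in_itv/= andbT.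
rewrite -[X in measurable X]setTI.
exact: normr_measurable.
Qed.

(** Half of the exponent is spent on the tail; what remains of the density is,
    up to the factor 2, the normal density of variance 2 s^2, of mass 1. *)
Lemma normal_prob_tail_le (s l : R) : s != 0 -> 0 <= l ->
  (normal_prob 0%R s [set x | (l < `|x|)%R] <= (2 * expR (- l ^+ 2 / (4 * s ^+ 2)))%:E)%E.
Proof.
move=> s0 l0; have s2 : 0 < s ^+ 2 by rewrite exprn_even_gt0.
pose s' := Num.sqrt 2 * s.
have s'0 : s' != 0 by rewrite mulf_neq0// gt_eqF// sqrtr_gt0.
have s'2 : s' ^+ 2 = 2 * s ^+ 2 by rewrite exprMn sqr_sqrtr.
set c := 2 * expR _.
have c0 : 0 <= c by rewrite mulr_ge0 ?expR_ge0.
apply: (@le_trans _ _ (\int[mu]_x (c * normal_pdf 0 s' x)%:E)%E); last first.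
  under eq_integral do rewrite EFinM.
  rewrite ge0_integralZl//.
  - by rewrite integral_normal_pdf mule1.
  - by apply/measurable_EFinP; exact: measurable_normal_pdf.
  - by move=> x _; rewrite lee_fin normal_pdf_ge0.
apply: (@le_trans _ _ (\int[mu]_(x in [set x | (l < `|x|)%R]) (c * normal_pdf 0 s' x)%:E)%E).
  apply: ge0_le_integral => //.
  - exact: measurable_abs_gt.
  - by move=> x _; rewrite lee_fin normal_pdf_ge0.
  - by apply: measurable_funTS; apply/measurable_EFinP; exact: measurable_normal_pdf.
  - apply: measurable_funTS; apply/measurable_EFinP; apply: measurable_funM => //.
    exact: measurable_normal_pdf.
  move=> x /= lx; rewrite lee_fin !normal_pdfE// /c.
  rewrite mulrACA.
  have -> : normal_fun 0 s x = expR (- x ^+ 2 / (4 * s ^+ 2)) * expR (- x ^+ 2 / (4 * s ^+ 2)).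
    rewrite -expRD /normal_fun subr0; congr expR.
    by rewrite -(mulr_natr (s ^+ 2)); field; lra.
  have -> : normal_fun 0 s' x = expR (- x ^+ 2 / (4 * s ^+ 2)).
    rewrite /normal_fun subr0 s'2; congr expR.
    by rewrite -mulr_natr; field; lra.
  apply: ler_pM; rewrite ?mulr_ge0 ?normal_peak_ge0 ?expR_ge0//.
    have := mulr_gt0 s2 (@pi_gt0 R) => sp0.
    have A0 : 0 < Num.sqrt (s ^+ 2 * pi *+ 2) by rewrite sqrtr_gt0 pmulrn_lgt0.
    have B0 : 0 < Num.sqrt (s' ^+ 2 * pi *+ 2).
      by rewrite sqrtr_gt0 pmulrn_lgt0// s'2 -mulrA mulr_gt0.
    rewrite /normal_peak ler_pdivlMr// mulrC ler_pdivrMr//.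
    rewrite -[2 in leRHS]ger0_norm// -sqrtr_sqr -sqrtrM ?sqr_ge0//.
    by rewrite ler_wsqrtr// s'2; lra.
  apply: ler_wpM2r; first exact: expR_ge0.
  have s4 : 0 < 4 * s ^+ 2 by rewrite pmulr_rgt0.
  rewrite ler_expR ler_pM2r ?invr_gt0// lerN2.
  by rewrite -[leRHS]real_normK ?num_real// lerXn2r ?nnegrE// (ltW lx).
apply: ge0_subset_integral => //.
- exact: measurable_abs_gt.
- apply/measurable_EFinP; apply: measurable_funM => //.
  exact: measurable_normal_pdf.
- by move=> x _; rewrite lee_fin mulr_ge0 ?normal_pdf_ge0.
Qed.

End gaussian.

Section gaussian_variable.
Context {d : measure_display} {Omega : measurableType d} {R : realType}.
Variable P : probability Omega R.
Local Notation mu := lebesgue_measure.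

Lemma measurable_abs_gt_comp (Z : Omega -> R) (b : R) :
  measurable_fun setT Z -> measurable [set w | b < `|Z w|].
Proof.
move=> mZ; rewrite -[X in measurable X]setTI.
rewrite (_ : mkset _ = Z @^-1` [set x | b < `|x|])//.
by apply: mZ => //; exact: measurable_abs_gt.
Qed.

(** The parameter s of the law is controlled by the second moment: at least half
    of the mass lies outside [-|s|/2, |s|/2], so E S^2 >= s^2 / 8. With the
    constant 4 of the tail of the law this gives 32. *)
Lemma centered_gaussian_tail (S : Omega -> R) (v l : R) :
  centered_gaussian P S -> 0 < v -> 0 <= l ->
  ('E_P[fun w => (S w ^+ 2)%R] <= v%:E)%E ->
  (P [set w | (l < `|S w|)%R] <= (2 * expR (- l ^+ 2 / (32 * v)))%:E)%E.
Proof.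
move=> [mS [s HS]] v0 l0 Sv.
have pre (a : R) : [set w | a < `|S w|] = S @^-1` [set x | a < `|x|] by [].
rewrite pre HS; last exact: measurable_abs_gt.
case: ifPn => [_|s0].
  rewrite diracE memNset; first by rewrite lee_fin mulr_ge0 ?expR_ge0.
  by rewrite /= normr0; apply/negP; rewrite -leNgt.
have s2 : 0 < s ^+ 2 by rewrite exprn_even_gt0.
apply: (le_trans (normal_prob_tail_le s l s0 l0)); rewrite lee_fin ler_pM2l// ler_expR.
have s4 : 0 < 4 * s ^+ 2 by rewrite pmulr_rgt0.
rewrite !mulNr lerN2 ler_wpM2l ?sqr_ge0// lef_pV2 ?posrE//; last by rewrite pmulr_rgt0.
suff : s ^+ 2 / 8 <= v by move=> ?; lra.
rewrite -lee_fin; apply: le_trans Sv.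
have mid : (P [set w | (`|s| / 2 < `|S w|)%R] >= (2^-1)%:E)%E.
  rewrite pre HS; last exact: measurable_abs_gt.
  rewrite (negbTE s0).
  have -> : [set x : R | `|s| / 2 < `|x|] = ~` `[- (`|s| / 2), `|s| / 2]%classic.
    apply/seteqP; split => x /=; rewrite in_itv/= -ler_norml => H.
      by apply/negP; rewrite -ltNge.
    by rewrite ltNge; apply/negP.
  set I := `[_, _]%classic; have mI : measurable I by exact: measurable_itv.
  suff NI : (normal_prob 0 s I <= (2^-1)%:E)%E.
    rewrite probability_setC// leeBrDr ?fin_num_measure//.
    apply: (le_trans (leeD (lexx _) NI)); rewrite -EFinD lee_fin; lra.
  apply: (@le_trans _ _ (\int[mu]_(x in `[(- (`|s| / 2))%R, (`|s| / 2)%R]) (normal_peak s)%:E)%E).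
    apply: ge0_le_integral => //.
    - by move=> x _; rewrite lee_fin normal_pdf_ge0.
    - by apply: measurable_funTS; apply/measurable_EFinP; exact: measurable_normal_pdf.
    - by move=> x _; rewrite lee_fin normal_pdf_ub.
  rewrite integral_cst//= /I lebesgue_measure_itv/= lte_fin.
  have s0' : 0 < `|s| by rewrite normr_gt0.
  rewrite ifT; last lra.
  rewrite -EFinB -EFinM lee_fin (_ : `|s| / 2 - - (`|s| / 2) = `|s|); last by field.
  by have := normal_peak_le s s0; lra.
have mA : measurable [set w | (`|s| / 2 < `|S w|)%R].
  exact: measurable_abs_gt_comp.
apply: (@le_trans _ _ ((s ^+ 2 / 4)%:E * P [set w | (`|s| / 2 < `|S w|)%R])%E).
  apply: (@le_trans _ _ ((s ^+ 2 / 4)%:E * (2^-1)%:E)%E).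
    by rewrite -EFinM lee_fin; lra.
  by apply: lee_wpmul2l => //; rewrite lee_fin; lra.
rewrite unlock -integral_cst//.
apply: (@le_trans _ _ (\int[P]_(w in [set w | (`|s| / 2 < `|S w|)%R]) (S w ^+ 2)%:E)%E).
  apply: ge0_le_integral => //.
  - by move=> x _; rewrite lee_fin; lra.
  - by apply: measurable_funTS; apply/measurable_EFinP; exact: measurable_funX.
  - move=> w /= sw; rewrite lee_fin.
    rewrite -(real_normK (num_real s)) -(real_normK (num_real (S w))).
    by have := normr_ge0 s; nra.
apply: ge0_subset_integral => //.
- by apply/measurable_EFinP; exact: measurable_funX.
- by move=> w _; rewrite lee_fin sqr_ge0.
Qed.

End gaussian_variable.

(** * The isometry of the noise *)

Section isometry.
Context {d : measure_display} {Omega : measurableType d} {R : realType}.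
Variable P : probability Omega R.
Variables (T : R) (W : set (R * R) -> Omega -> R).
Hypothesis hW : white_noise P T W.

Lemma measurable_spacetime : measurable (spacetime T).
Proof. by apply: measurableX; exact: measurable_itv. Qed.

(** Lebesgue measure is defined on a copy of R with its own display, so the
    measurability of the slab is also needed there. *)
Let mST : measurable (spacetime T : set (measurableTypeR R * measurableTypeR R)).
Proof. exact: measurable_spacetime. Qed.

Lemma lambda2_spacetime_lty (A : set (R * R)) : measurable A -> A `<=` spacetime T ->
  (lambda2 R A < +oo)%E.
Proof.
move=> mA AS; apply: (@le_lt_trans _ _ (lambda2 R (spacetime T))).
  by apply: le_measure; rewrite ?inE//; exact: measurable_spacetime.
have -> : lambda2 R (spacetime T) =
    (lebesgue_measure (`[0%R, T]%classic : set R) * lebesgue_measure (@torus R))%E.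
  by apply: product_measure1E; exact: measurable_itv.
by rewrite lebesgue_torus mule1 lebesgue_measure_itv/=; case: ifP => _; rewrite -?EFinB ltry.
Qed.

Lemma measurable_noise (A : set (R * R)) : measurable A -> A `<=` spacetime T ->
  measurable_fun setT (W A).
Proof.
move=> mA AS; have [hG _] := hW.
have [|+ _] := hG [:: (1, A)].
  by move=> cA; rewrite inE => /eqP ->.
rewrite (_ : step_noise W _ = W A)//.
by apply/funext => w; rewrite /step_noise big_seq1 mul1r.
Qed.

Lemma noise_prod_integrable (A B : set (R * R)) (c : R) :
  measurable A -> A `<=` spacetime T ->
  measurable B -> B `<=` spacetime T ->
  P.-integrable setT (EFin \o (fun w => c * (W A w * W B w))).
Proof.
move=> mA AS mB BS.
have sq C : measurable C -> C `<=` spacetime T ->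
    P.-integrable setT (EFin \o (fun w => W C w * W C w)).
  move=> mC CS; have mW := measurable_noise C mC CS.
  apply/integrableP; split.
    by apply/measurable_EFinP; exact: measurable_funM.
  have [_ /(_ C C mC CS mC CS)] := hW; rewrite unlock setIid => EC.
  under eq_integral do rewrite /= ger0_norm -?expr2 ?sqr_ge0//.
  under eq_integral do rewrite expr2.
  by rewrite EC; exact: lambda2_spacetime_lty.
have mWA := measurable_noise A mA AS.
have mWB := measurable_noise B mB BS.
have : P.-integrable setT (EFin \o (fun w => W A w * W B w)).
  apply: (le_integrable measurableT _ _ (integrableD measurableT (sq A mA AS) (sq B mB BS))).
    by apply/measurable_EFinP; exact: measurable_funM.
  move=> w _ /=; rewrite lee_fin normrM [leRHS]ger0_norm; last first.
    by rewrite addr_ge0// -expr2 sqr_ge0.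
  rewrite -!expr2 -(real_normK (num_real (W A w))) -(real_normK (num_real (W B w))).
  by have := normr_ge0 (W A w); have := normr_ge0 (W B w); nra.
by move=> /(integrableZl measurableT c); apply: eq_integrable.
Qed.

Lemma indic_prod_integrable (A B : set (R * R)) (c : R) :
  measurable A -> A `<=` spacetime T ->
  measurable B -> B `<=` spacetime T ->
  (lambda2 R).-integrable (spacetime T) (EFin \o (fun z => c * (\1_A z * \1_B z))).
Proof.
move=> mA AS mB BS.
have AB : (lambda2 R).-integrable (spacetime T) (EFin \o \1_(A `&` B)).
  apply/integrableP; split.
    by apply/measurable_EFinP; apply: measurable_indic; exact: measurableI.
  under eq_integral do rewrite /= ger0_norm//.
  rewrite integral_indic; last (by exact: measurableI); last (by exact: mST).
  apply: lambda2_spacetime_lty; last by apply: subIset; right.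
  by apply: measurableI; [exact: measurableI|exact: measurable_spacetime].
have := integrableZl mST c AB; apply: eq_integrable => //.
by move=> z _ /=; rewrite indicI.
Qed.

(** Both sides expand into the same double sum over the entries of the step
    function, by the covariance of the noise. *)
Lemma step_noise_isometry (h : seq (R * set (R * R))) : step_on (spacetime T) h ->
  ('E_P[fun w => (step_noise W h w ^+ 2)%R] =
   \int[lambda2 R]_(z in spacetime T) (step_fun h z ^+ 2)%:E)%E.
Proof.
move=> hh; have [_ hcov] := hW.
(* Indexing by ordinals makes the hypothesis on the entries hold for all indices. *)
pose p (i : 'I_(size h)) := nth (0, set0) h i.
have ph i : measurable (p i).2 /\ (p i).2 `<=` spacetime T.
  by apply: hh; exact: mem_nth.
have noiseE w : step_noise W h w ^+ 2 =
    \sum_i \sum_j ((p i).1 * (p j).1) * (W (p i).2 w * W (p j).2 w).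
  rewrite /step_noise (big_nth (0, set0)) big_mkord expr2 big_distrlr/=.
  by apply: eq_bigr => i _; apply: eq_bigr => j _; rewrite mulrACA.
have funE z : step_fun h z ^+ 2 =
    \sum_i \sum_j ((p i).1 * (p j).1) * (\1_((p i).2) z * \1_((p j).2) z).
  rewrite /step_fun (big_nth (0, set0)) big_mkord expr2 big_distrlr/=.
  by apply: eq_bigr => i _; apply: eq_bigr => j _; rewrite mulrACA.
rewrite unlock.
under eq_integral do rewrite noiseE pair_big/= -sumEFin.
under [in RHS]eq_integral do rewrite funE pair_big/= -sumEFin.
rewrite integral_sum//; last first.
  move=> -[i j]; have [mi iS] := ph i; have [mj jS] := ph j.
  exact: noise_prod_integrable.
rewrite integral_sum//; first last.
  move=> -[i j]; have [mi iS] := ph i; have [mj jS] := ph j.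
  exact: indic_prod_integrable.
apply: eq_bigr => -[i j] _ /=; have [mi iS] := ph i; have [mj jS] := ph j.
under eq_integral do rewrite EFinM.
rewrite integralZl//; last first.
  have := noise_prod_integrable _ _ 1 mi iS mj jS.
  by apply: eq_integrable => // w _ /=; rewrite mul1r.
under [in RHS]eq_integral do rewrite EFinM.
rewrite integralZl//; first last.
  have := indic_prod_integrable _ _ 1 mi iS mj jS.
  apply: eq_integrable => //.
  by move=> w _ /=; rewrite mul1r.
congr (_ * _)%E; have := hcov _ _ mi iS mj jS; rewrite unlock => ->.
under eq_integral => z _.
  rewrite (_ : _ * _ = \1_((p i).2 `&` (p j).2) z); last by rewrite indicI.
  over.
have mij : measurable ((p i).2 `&` (p j).2 : set (measurableTypeR R * measurableTypeR R)).
  by apply: measurableI; [exact: mi|exact: mj].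
rewrite (integral_indic _ mST)//.
have -> // : (p i).2 `&` (p j).2 `&` spacetime T = (p i).2 `&` (p j).2.
by apply/setIidl; apply: subIset; left.
Qed.

End isometry.

(** * Square increments of the heat kernel *)

Section tonelli_rectangle.
Context {d1 d2 : measure_display} {T1 : measurableType d1} {T2 : measurableType d2}
  {R : realType}.
Variables (m1 : {sigma_finite_measure set T1 -> \bar R})
  (m2 : {sigma_finite_measure set T2 -> \bar R}).

Lemma integral_setX_tonelli (D : set T1) (E : set T2) (f : T1 * T2 -> \bar R) :
  measurable D -> measurable E -> measurable_fun setT f -> (forall z, 0 <= f z)%E ->
  (\int[m1 \x m2]_(z in D `*` E) f z = \int[m1]_(x in D) \int[m2]_(y in E) f (x, y))%E.
Proof.
move=> mD mE mf f0.
have mDE : measurable (D `*` E) by exact: measurableX.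
rewrite integral_mkcond fubini_tonelli1; first last.
- by move=> z; apply: erestrict_ge0 => {}z _; exact: f0.
- by apply/(measurable_restrictT f mDE); exact: measurable_funTS.
rewrite [RHS]integral_mkcond; apply: eq_integral => x _.
rewrite patchE /fubini_F; case: ifPn => xD.
  rewrite [RHS]integral_mkcond; apply: eq_integral => y _.
  rewrite !patchE; congr (if _ then _ else _).
  move: xD; rewrite inE => xD.
  by apply/idP/idP; rewrite !inE; [case|move=> yE; split].
apply: integral0_eq => y _; rewrite patchE ifF//; apply/negbTE.
by move: xD; apply: contra; rewrite !inE => -[].
Qed.

End tonelli_rectangle.

Section kernel_increment.
Context {R : realType}.
Local Notation mu := lebesgue_measure.

(** One factor of the square is estimated by the Hoelder bound, whose singularity
    in time is integrable as eta < 1, and the other factor by the sum of two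
    kernels, each of mass at most pi. *)
Lemma heat_kernel_increment_L2 (t eta : R) : 0 <= t -> 0 < eta < 1 ->
  exists K : R, 0 < K /\ forall x y, torus x -> torus y ->
  (\int[lambda2 R]_(z in spacetime t)
     ((heat_kernel (t - z.1) (x - z.2) - heat_kernel (t - z.1) (y - z.2)) ^+ 2)%:E
   <= (K * torus_dist x y `^ eta)%:E)%E.
Proof.
move=> t0 /andP[e0 e1]; have T0 : 0 < t + 1 by rewrite ltr_wpDl.
have e01 : 0 < eta <= 1 by rewrite e0 ltW.
have [C [C0 HC]] := heat_kernel_torus_holder (t + 1) eta T0 e01.
pose a := (1 + eta) / 2.
have a01 : 0 <= a < 1 by rewrite /a; lra.
pose J := fine (\int[mu]_(s in `[0%R, t]) ((t - s) `^ (- a))%:E)%E.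
have J0 : 0 <= J by apply: fine_ge0; apply: integral_ge0 => s _; rewrite lee_fin powR_ge0.
have JE : (J%:E = \int[mu]_(s in `[0%R, t]) ((t - s) `^ (- a))%:E)%E.
  rewrite /J fineK// ge0_fin_numE; first exact: integral_powR_sub_lty.
  by apply: integral_ge0 => s _; rewrite lee_fin powR_ge0.
exists (C * (pi + pi) * J + 1); split.
  by rewrite ltr_wpDl// !mulr_ge0// addr_ge0// pi_ge0.
move=> x y tx ty; set D := torus_dist x y `^ eta.
have D0 : 0 <= D by exact: powR_ge0.
have mhk x' : measurable_fun setT (fun z : R * R => heat_kernel (t - z.1) (x' - z.2)).
  by apply: measurable_heat_kernel; exact: measurable_funB.
have mhks x' s : measurable_fun setT (fun z : R => (heat_kernel (t - s) (x' - z))%:E).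
  by apply/measurable_EFinP; apply: measurable_heat_kernel => //; exact: measurable_funB.
pose f (z : R * R) := ((heat_kernel (t - z.1) (x - z.2) - heat_kernel (t - z.1) (y - z.2)) ^+ 2)%:E.
have mf : measurable_fun setT f.
  by apply/measurable_EFinP; apply: measurable_funX; exact: measurable_funB.
have f0 z : (0 <= f z)%E by rewrite lee_fin sqr_ge0.
have -> : (\int[lambda2 R]_(z in spacetime t) f z =
    \int[mu]_(s in `[0%R, t]) \int[mu]_(z in @torus R) f (s, z))%E.
  by apply: integral_setX_tonelli => //; exact: measurable_torus.
have inner s : 0 <= s -> s <= t ->
    (\int[mu]_(z in @torus R) f (s, z) <= (C * D * (pi + pi))%:E * ((t - s) `^ (- a))%:E)%E.
  move=> s0 st; have tsT : t - s <= t + 1 by lra.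
  have c0 : 0 <= C * D * (t - s) `^ (- a) by rewrite !mulr_ge0 ?powR_ge0.
  apply: (@le_trans _ _ (\int[mu]_(z in @torus R) ((C * D * (t - s) `^ (- a))%:E *
     ((heat_kernel (t - s) (x - z))%:E + (heat_kernel (t - s) (y - z))%:E)))%E).
    apply: ge0_le_integral => //.
    - exact: measurable_torus.
    - by apply: measurable_funTS; apply: (measurableT_comp mf); exact: measurable_fun_pair.
    - apply: measurable_funTS; apply: measurable_funeM; apply: emeasurable_funD; exact: mhks.
    - move=> z tz; rewrite /f -EFinD -EFinM lee_fin -real_normK ?num_real// expr2.
      apply: ler_pM => //; first by rewrite mulrAC; exact: HC.
      apply: (le_trans (ler_normB _ _)).
      by rewrite !ger0_norm ?heat_kernel_ge0.
  rewrite ge0_integralZl//; first last.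
  - by move=> z _; rewrite adde_ge0// lee_fin heat_kernel_ge0.
  - apply: measurable_funTS; apply: emeasurable_funD; exact: mhks.
  - exact: measurable_torus.
  rewrite ge0_integralD//; first last.
  - by apply: measurable_funTS; exact: mhks.
  - by move=> z _; rewrite lee_fin heat_kernel_ge0.
  - by apply: measurable_funTS; exact: mhks.
  - by move=> z _; rewrite lee_fin heat_kernel_ge0.
  - exact: measurable_torus.
  rewrite -EFinM [leRHS](_ : _ = ((C * D * (t - s) `^ (- a))%:E * (pi%:E + pi%:E)))%E; last first.
    by rewrite -EFinD -EFinM; congr EFin; ring.
  by apply: lee_wpmul2l => //; apply: leeD; exact: heat_kernel_mass.
have mF : measurable_fun setT (fun s => \int[mu]_(z in @torus R) f (s, z))%E.
  exact: (measurable_fun_ge0_integral mu (@torus R) f measurable_torus).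
have mw : measurable_fun setT (fun s : R => ((t - s) `^ (- a))%:E).
  apply/measurable_EFinP; apply: (measurableT_comp (measurable_powR _)).
  exact: measurable_funB.
apply: (@le_trans _ _ (\int[mu]_(s in `[0%R, t]) ((C * D * (pi + pi))%:E * ((t - s) `^ (- a))%:E))%E).
  apply: ge0_le_integral => //.
  - by move=> s _; apply: integral_ge0.
  - exact: measurable_funTS.
  - by apply: measurable_funTS; exact: measurable_funeM.
  - by move=> s /=; rewrite in_itv/= => /andP[s0 st]; exact: inner.
rewrite ge0_integralZl//; first last.
- by rewrite lee_fin !mulr_ge0// addr_ge0// pi_ge0.
- by move=> s _; rewrite lee_fin powR_ge0.
- exact: measurable_funTS.
rewrite -JE -EFinM lee_fin mulrDl mul1r.
rewrite (_ : C * D * (pi + pi) * J = C * (pi + pi) * J * D); last by ring.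
by rewrite lerDl.
Qed.

End kernel_increment.

(** * Tails of Wiener integrals *)

Section wiener_tail.
Context {d : measure_display} {Omega : measurableType d} {R : realType}.
Variable P : probability Omega R.
Variables (T : R) (W : set (R * R) -> Omega -> R).
Hypothesis hW : white_noise P T W.

(** Lebesgue measure is defined on a copy of R with its own display, so the
    measurability of the slab is also needed there. *)
Let mST : measurable (spacetime T : set (measurableTypeR R * measurableTypeR R)).
Proof. exact: measurable_spacetime. Qed.

Definition step_sub (h g : seq (R * set (R * R))) : seq (R * set (R * R)) :=
  h ++ [seq (- c.1, c.2) | c <- g].

Lemma step_on_sub D h g : step_on D h -> step_on D g -> step_on D (step_sub h g).
Proof.
move=> hh hg cA; rewrite mem_cat => /orP[/hh//|/mapP[c /hg cD ->]//].
Qed.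

Lemma step_fun_sub h g z : step_fun (step_sub h g) z = step_fun h z - step_fun g z.
Proof.
rewrite /step_fun big_cat big_map /= -sumrN; congr (_ + _).
by apply: eq_bigr => c _; rewrite mulNr.
Qed.

Lemma step_noise_sub h g w :
  step_noise W (step_sub h g) w = step_noise W h w - step_noise W g w.
Proof.
rewrite /step_noise big_cat big_map /= -sumrN; congr (_ + _).
by apply: eq_bigr => c _; rewrite mulNr.
Qed.

Lemma measurable_step_fun h : step_on (spacetime T) h ->
  measurable_fun [set: R * R] (@step_fun R h).
Proof.
elim: h => [|c h IH] hh.
  by rewrite (_ : step_fun _ = cst 0)//; apply/funext => z; rewrite /step_fun big_nil.
rewrite (_ : step_fun _ = fun z => c.1 * \1_(c.2) z + step_fun h z); last first.
  by apply/funext => z; rewrite /step_fun big_cons.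
have [mc _] : measurable c.2 /\ c.2 `<=` spacetime T by apply: hh; rewrite mem_head.
apply: measurable_funD.
  by apply: measurable_funM => //; exact: measurable_indic.
by apply: IH => cA cAh; apply: hh; rewrite inE cAh orbT.
Qed.

Lemma measurable_step_noise h : step_on (spacetime T) h ->
  measurable_fun setT (step_noise W h).
Proof. by have [hG _] := hW; move=> /hG[]. Qed.

Lemma chebyshev_sqr (Z : Omega -> R) (a : R) : measurable_fun setT Z -> 0 < a ->
  (P [set w | (a < `|Z w|)%R] <= (a ^- 2)%:E * 'E_P[fun w => (Z w ^+ 2)%R])%E.
Proof.
move=> mZ a0.
have mA : measurable [set w | a < `|Z w|].
  exact: measurable_abs_gt_comp.
have a2 : 0 < a ^+ 2 by rewrite exprn_gt0.
rewrite -[leLHS]mul1e -(@divff _ (a ^+ 2)) ?gt_eqF// [_ / _]mulrC EFinM -muleA.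
apply: lee_wpmul2l; first by rewrite lee_fin invr_ge0 ltW.
rewrite unlock -integral_cst//.
apply: (@le_trans _ _ (\int[P]_(w in [set w | (a < `|Z w|)%R]) (Z w ^+ 2)%:E)%E).
  apply: ge0_le_integral => //.
  - by move=> w _; rewrite lee_fin ltW.
  - by apply: measurable_funTS; apply/measurable_EFinP; exact: measurable_funX.
  - move=> w /= aw; rewrite lee_fin -(real_normK (num_real (Z w))).
    by rewrite lerXn2r ?nnegrE// ltW.
apply: ge0_subset_integral => //.
- by apply/measurable_EFinP; exact: measurable_funX.
- by move=> w _; rewrite lee_fin sqr_ge0.
Qed.

(** The step noises converge to I and J in L^2. The difference of the step noises
    is Gaussian of variance at most 9 v, three terms of size v being involved;
    it takes half of l, hence l / 6 in the exponent. Each of the two errors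
    takes a quarter of l, and Chebyshev's inequality makes them negligible. *)
Lemma wiener_integral_sub_tail (phi psi : R * R -> R) (I J : Omega -> R) (v l : R) :
  wiener_integral P W (spacetime T) phi I ->
  wiener_integral P W (spacetime T) psi J ->
  measurable_fun setT phi -> measurable_fun setT psi ->
  0 < v -> 0 < l ->
  (\int[lambda2 R]_(z in spacetime T) ((phi z - psi z) ^+ 2)%:E <= v%:E)%E ->
  (P [set w | (l < `|I w - J w|)%R] <= (2 * expR (- (l / 6) ^+ 2 / (32 * v)))%:E)%E.
Proof.
move=> [mI [h [hh hphi hI]]] [mJ [g [gg gpsi gJ]]] mphi mpsi v0 l0 hv.
apply/lee_addgt0Pr => e e0.
pose c := l ^+ 2 / 16.
have c0 : 0 < c by rewrite divr_gt0 ?exprn_gt0.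
have ev (F : nat -> \bar R) (b : R) : F @ \oo --> 0%E -> 0 < b ->
    \forall n \near \oo, (F n <= b%:E)%E.
  move=> F0 b0.
  have /F0 : nbhs (0%:E : \bar R) [set x | (x <= b%:E)%E].
    apply: (@filterS _ _ _ [set x | (x < b%:E)%E]); first by move=> x /ltW.
    by apply: open_nbhs_nbhs; split; [exact: open_ereal_lt_ereal|rewrite /= lte_fin].
  by [].
have eh := ev _ _ hphi v0; have eg := ev _ _ gpsi v0.
have ce0 : 0 < c * (e / 2) by rewrite mulr_gt0// divr_gt0.
have eI := ev _ _ hI ce0; have eJ := ev _ _ gJ ce0.
have : \forall n \near \oo,
   [/\ (\int[lambda2 R]_(z in spacetime T) ((phi z - step_fun (h n) z) ^+ 2)%:E <= v%:E)%E,
       (\int[lambda2 R]_(z in spacetime T) ((psi z - step_fun (g n) z) ^+ 2)%:E <= v%:E)%E,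
       ('E_P[fun w => ((I w - step_noise W (h n) w) ^+ 2)%R] <= (c * (e / 2))%:E)%E &
       ('E_P[fun w => ((J w - step_noise W (g n) w) ^+ 2)%R] <= (c * (e / 2))%:E)%E].
  by near=> n; split; near: n.
move=> [N _ /(_ N (leqnn N))] [{}eh {}eg {}eI {}eJ].
pose k := step_sub (h N) (g N).
have hk : step_on (spacetime T) k by exact: step_on_sub.
have mh := measurable_step_fun _ (hh N); have mg := measurable_step_fun _ (gg N).
have msq (q : R * R -> R) : measurable_fun setT q ->
    measurable_fun (spacetime T : set (measurableTypeR R * measurableTypeR R))
      (fun z => (q z ^+ 2)%:E).
  by move=> mq; apply: measurable_funTS; apply/measurable_EFinP; exact: measurable_funX.
have m1 : measurable_fun setT (fun z => phi z - step_fun (h N) z) by exact: measurable_funB.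
have m2 : measurable_fun setT (fun z => psi z - step_fun (g N) z) by exact: measurable_funB.
have m3 : measurable_fun setT (fun z => phi z - psi z) by exact: measurable_funB.
have vark : ('E_P[fun w => (step_noise W k w ^+ 2)%R] <= (9 * v)%:E)%E.
  rewrite (step_noise_isometry P T W hW)//.
  apply: (@le_trans _ _ (\int[lambda2 R]_(z in spacetime T) (3%:E *
     ((((phi z - step_fun (h N) z) ^+ 2)%:E + ((psi z - step_fun (g N) z) ^+ 2)%:E) +
       ((phi z - psi z) ^+ 2)%:E)))%E).
    apply: ge0_le_integral => //.
    - by move=> z _; rewrite lee_fin sqr_ge0.
    - by apply: msq; exact: measurable_step_fun.
    - apply: measurable_funeM; apply: emeasurable_funD; last exact: msq.
      by apply: emeasurable_funD; exact: msq.
    - move=> z _; rewrite -!EFinD -EFinM lee_fin step_fun_sub.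
      set A := step_fun _ z; set B := step_fun _ z.
      have -> : A - B = - (phi z - A) + (psi z - B) + (phi z - psi z) by ring.
      set p := phi z - A; set q := psi z - B; set r := phi z - psi z.
      have := sqr_ge0 (p + q); have := sqr_ge0 (p + r); have := sqr_ge0 (q - r); nra.
  rewrite ge0_integralZl//; first last.
  - by move=> z _; rewrite !adde_ge0// lee_fin sqr_ge0.
  - apply: emeasurable_funD; last exact: msq.
    by apply: emeasurable_funD; exact: msq.
  rewrite ge0_integralD//; first last.
  - exact: msq.
  - by move=> z _; rewrite lee_fin sqr_ge0.
  - by apply: emeasurable_funD; exact: msq.
  - by move=> z _; rewrite !adde_ge0// lee_fin sqr_ge0.
  rewrite ge0_integralD//; first last.
  - exact: msq.
  - by move=> z _; rewrite lee_fin sqr_ge0.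
  - exact: msq.
  - by move=> z _; rewrite lee_fin sqr_ge0.
  rewrite [leRHS](_ : _ = 3%:E * (v%:E + v%:E + v%:E))%E; last first.
    by rewrite -!EFinD -EFinM; congr EFin; ring.
  by apply: lee_wpmul2l => //; apply: leeD => //; exact: leeD.
have [hG _] := hW.
have v9 : 0 < 9 * v by rewrite mulr_gt0.
have l2 : 0 <= l / 2 by lra.
have tail := centered_gaussian_tail P _ _ _ (hG _ hk) v9 l2 vark.
have l4 : 0 < l / 4 by lra.
have mSh := measurable_step_noise _ (hh N); have mSg := measurable_step_noise _ (gg N).
have mSk := measurable_step_noise _ hk.
have mIh : measurable_fun setT (fun w => I w - step_noise W (h N) w) by exact: measurable_funB.
have mJg : measurable_fun setT (fun w => J w - step_noise W (g N) w) by exact: measurable_funB.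
have mgt := @measurable_abs_gt_comp _ Omega R.
have cheb (Z : Omega -> R) : measurable_fun setT Z ->
    ('E_P[fun w => (Z w ^+ 2)%R] <= (c * (e / 2))%:E)%E ->
    (P [set w | (l / 4 < `|Z w|)%R] <= (e / 2)%:E)%E.
  move=> mZ EZ; apply: (le_trans (chebyshev_sqr _ _ mZ l4)).
  rewrite [leRHS](_ : _ = ((l / 4) ^- 2)%:E * (c * (e / 2))%:E)%E; last first.
    by rewrite -EFinM; congr EFin; rewrite /c; field; lra.
  by apply: lee_wpmul2l => //; rewrite lee_fin invr_ge0 sqr_ge0.
apply: (@le_trans _ _ (P ([set w | (l / 2 < `|step_noise W k w|)%R] `|`
    ([set w | (l / 4 < `|I w - step_noise W (h N) w|)%R] `|`
     [set w | (l / 4 < `|J w - step_noise W (g N) w|)%R])))).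
  apply: le_measure; rewrite ?inE.
  - by apply: (mgt (fun w => I w - J w)); exact: measurable_funB.
  - by apply: measurableU; [exact: mgt|apply: measurableU; exact: mgt].
  move=> w /= lw; rewrite step_noise_sub.
  have [|a1] := ltP (l / 2) `|step_noise W (h N) w - step_noise W (g N) w|; first by left.
  have [|a2] := ltP (l / 4) `|I w - step_noise W (h N) w|; first by right; left.
  have [|a3] := ltP (l / 4) `|J w - step_noise W (g N) w|; first by right; right.
  exfalso; move: lw a1 a2 a3.
  set A := step_noise W (h N) w; set B := step_noise W (g N) w => lw a1 a2 a3.
  have IJ : I w - J w = (I w - A) + (A - B) - (J w - B) by ring.
  have := ler_normB ((I w - A) + (A - B)) (J w - B).
  have := ler_normD (I w - A) (A - B).
  by rewrite -IJ; lra.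
apply: (le_trans (measureU2 _ _ _)).
- exact: mgt.
- by apply: measurableU; exact: mgt.
apply: leeD.
  apply: (le_trans tail); rewrite lee_fin ler_pM2l// ler_expR le_eqVlt.
  by apply/orP; left; apply/eqP; field; lra.
apply: (le_trans (measureU2 _ _ _)); [exact: mgt|exact: mgt|].
have -> : e%:E = ((e / 2)%:E + (e / 2)%:E)%E.
  by rewrite -EFinD; congr EFin; field.
by apply: leeD; exact: cheb.
Unshelve. all: by end_near. Qed.

End wiener_tail.

(** * Dyadic points of the torus *)

Section dyadic.
Context {R : realType}.

Definition dyadic (n k : nat) : R := k%:R / (2 ^ n)%:R.

Definition dyadic_index (n : nat) (x : R) : nat := Num.truncn ((2 ^ n)%:R * x).

Definition dyadic_approx (n : nat) (x : R) : R := dyadic n (dyadic_index n x).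

Lemma pow2_gt0 n : 0 < (2 ^ n)%:R :> R.
Proof. by rewrite ltr0n expn_gt0. Qed.

Lemma dyadic_index_itv n x : torus x ->
  (dyadic_index n x)%:R <= (2 ^ n)%:R * x < (dyadic_index n x).+1%:R.
Proof.
rewrite /torus /= in_itv/= => /andP[x0 _].
by apply: truncn_itv; rewrite mulr_ge0// ltW.
Qed.

Lemma dyadic_index_lt n x : torus x -> (dyadic_index n x < 2 ^ n)%N.
Proof.
move=> tx; have /andP[+ _] := dyadic_index_itv n x tx.
move: tx; rewrite /torus /= in_itv/= => /andP[_ x1] jx.
by rewrite -(ltr_nat R) (le_lt_trans jx)// -[ltRHS]mulr1 ltr_pM2l.
Qed.

Lemma dyadic_torus n k : (k < 2 ^ n)%N -> torus (dyadic n k).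
Proof.
move=> kn; rewrite /torus /= in_itv/= divr_ge0//= ltr_pdivrMr// mul1r.
by rewrite ltr_nat.
Qed.

Lemma dyadic_approx_torus n x : torus x -> torus (dyadic_approx n x).
Proof. by move=> tx; apply: dyadic_torus; exact: dyadic_index_lt. Qed.

Lemma dyadic_approx_dist n x : torus x -> `|x - dyadic_approx n x| <= (2 ^ n)%:R^-1.
Proof.
move=> tx; have /andP[lo hi] := dyadic_index_itv n x tx.
rewrite /dyadic_approx /dyadic ger0_norm; last first.
  by rewrite subr_ge0 ler_pdivrMr// mulrC.
rewrite lerBlDr -{1}[_^-1]mul1r -mulrDl ler_pdivlMr// mulrC.
by rewrite nat1r ltW.
Qed.

Lemma cvg_geometric_increments (u : nat -> R) (C rho : R) : 0 < rho < 1 -> 0 <= C ->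
  (forall n, `|u n.+1 - u n| <= C * rho ^+ n) ->
  cvgn u /\ forall n, `|limn u - u n| <= C / (1 - rho) * rho ^+ n.
Proof.
move=> /andP[r0 r1] C0 Hu.
have r1' : 0 < 1 - rho by rewrite subr_gt0.
have dist n m : `|u (n + m)%N - u n| <= C / (1 - rho) * rho ^+ n.
  suff : `|u (n + m)%N - u n| <= C / (1 - rho) * rho ^+ n * (1 - rho ^+ m).
    move=> /le_trans; apply; rewrite ler_piMr//; last first.
      by rewrite gerBl exprn_ge0// ltW.
    by rewrite !mulr_ge0 ?invr_ge0 ?exprn_ge0// ltW.
  elim: m => [|m IH]; first by rewrite addn0 subrr normr0 expr0 subrr mulr0.
  rewrite addnS (_ : _ - _ = (u (n + m).+1 - u (n + m)%N) + (u (n + m)%N - u n)); last by ring.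
  apply: (le_trans (ler_normD _ _)).
  apply: (le_trans (lerD (Hu _) IH)).
  rewrite le_eqVlt; apply/orP; left; apply/eqP.
  by rewrite exprD exprS; field; lra.
have cu : cvgn u.
  apply: cauchy_cvg; apply: cauchy_exP => e e0.
  have : C / (1 - rho) * rho ^+ n @[n --> \oo] --> C / (1 - rho) * 0.
    by apply: cvgM; [exact: cvg_cst|apply: cvg_expr; rewrite ger0_norm ?ltW].
  rewrite mulr0 => /cvgrPdist_lt /(_ e e0) [N _ HN].
  exists (u N), N => // m /= Nm.
  have := HN N (leqnn N); rewrite /= sub0r normrN => hN.
  rewrite /ball /= distrC -(subnKC Nm) (le_lt_trans (dist _ _))//.
  exact: le_lt_trans (ler_norm _) hN.
split=> // n.
have cd : `|u m - u n| @[m --> \oo] --> `|limn u - u n|.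
  by apply: cvg_norm; apply: cvgB => //; exact: cvg_cst.
rewrite -(cvg_lim _ cd)//; apply: limr_le; first by apply/cvg_ex; eexists; exact: cd.
by exists n => // m /= nm; rewrite -(subnKC nm).
Qed.

End dyadic.

Section dyadic_holder.
Context {R : realType}.

Lemma powR2N_lt1 (delta : R) : 0 < delta -> 2 `^ (- delta) < 1 :> R.
Proof.
move=> d0; have e1 : 1 `^ delta = 1 :> R by rewrite powR1.
rewrite powRN invf_lt1 ?powR_gt0// -{1}e1.
by apply: gt0_ltr_powR; rewrite ?nnegrE ?ltr1n.
Qed.

Lemma dyadic_index_succ n (x : R) : torus x ->
  dyadic_index n.+1 x = (dyadic_index n x).*2 \/
  dyadic_index n.+1 x = (dyadic_index n x).*2.+1.
Proof.
move=> tx; have /andP[a1 a2] := dyadic_index_itv n x tx.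
have /andP[b1 b2] := dyadic_index_itv n.+1 x tx.
move: a1 a2 b1 b2; set j := dyadic_index n x; set k := dyadic_index n.+1 x.
rewrite expnS natrM -mulrA; set y := _ * x => a1 a2 b1 b2.
have k1 : (j.*2 < k.+1)%N.
  by rewrite -(ltr_nat R) -muln2 natrM; apply: le_lt_trans b2; lra.
have k2 : (k < j.*2.+2)%N.
  rewrite -(ltr_nat R) -doubleS -muln2 natrM; apply: (le_lt_trans b1); lra.
have [->|kj] := eqVneq k j.*2; first by left.
right; apply/eqP; rewrite eqn_leq; apply/andP; split; first by rewrite -ltnS.
by rewrite ltn_neqAle eq_sym kj -ltnS.
Qed.

Lemma dyadic_double n j : dyadic n.+1 j.*2 = dyadic n j :> R.
Proof.
by rewrite /dyadic -muln2 mulnC expnS !natrM invfM mulrACA divff// mul1r.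
Qed.

(** When the distance is realised across the point 0, the larger point has the
    last index and the smaller one the index 0, its cyclic successor. *)
Lemma dyadic_index_near n (x y : R) : torus x -> torus y -> y <= x ->
  torus_dist x y <= (2 ^ n)%:R^-1 ->
  [\/ dyadic_index n x = dyadic_index n y,
      dyadic_index n x = ((dyadic_index n y).+1 %% 2 ^ n)%N |
      dyadic_index n y = ((dyadic_index n x).+1 %% 2 ^ n)%N].
Proof.
move=> tx ty yx; rewrite /torus_dist ger0_norm ?subr_ge0//.
have /andP[a1 a2] := dyadic_index_itv n x tx.
have /andP[b1 b2] := dyadic_index_itv n y ty.
have jx := dyadic_index_lt n x tx; have jy := dyadic_index_lt n y ty.
move: a1 a2 b1 b2 jx jy; set j := dyadic_index n x; set k := dyadic_index n y.
set N := (2 ^ n)%N => a1 a2 b1 b2 jN kN.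
have N0 : 0 < N%:R :> R by exact: pow2_gt0.
have NyNx : N%:R * y <= N%:R * x by rewrite ler_pM2l.
rewrite ge_min -[N%:R^-1]mulr1 !ler_pdivlMl// !mulrBr mulr1 => /orP[xy|xy].
  have jE : (j < k.+2)%N by rewrite -(ltr_nat R); move: b2; rewrite -!natr1; lra.
  have kj : (k < j.+1)%N by rewrite -(ltr_nat R); lra.
  have [->|jnk] := eqVneq j k; first by constructor 1.
  constructor 2; have jk : j = k.+1.
    by apply/eqP; rewrite eqn_leq -ltnS jE ltn_neqAle eq_sym jnk -ltnS.
  by rewrite -jk modn_small.
constructor 3; have k0 : k = 0%N.
  apply/eqP; rewrite -leqn0 -ltnS -(ltr_nat R).
  by move: tx; rewrite /torus /= in_itv/= => /andP[_ x1]; nra.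
have jE : j.+1 = N.
  apply/eqP; rewrite eqn_leq jN -ltnS -(ltr_nat R) -natr1.
  move: ty; rewrite /torus /= in_itv/= => /andP[y0 _].
  by have := mulr_ge0 (ltW N0) y0; rewrite -natr1 in a2; rewrite -natr1; lra.
by rewrite jE modnn.
Qed.

Lemma exists_dyadic_scale (d : R) : 0 < d <= 1 ->
  exists n : nat, (2 ^ n.+1)%:R^-1 < d <= (2 ^ n)%:R^-1.
Proof.
move=> /andP[d0 d1].
have ex : exists n, (2 ^ n)%:R^-1 < d.
  exists (Num.truncn d^-1).+1; rewrite invf_plt ?posrE//.
  apply: (lt_trans (truncnS_gt _)); rewrite ltr_nat.
  exact: ltn_expl.
have [m md mmin] := ex_minnP ex.
case: m md mmin => [|n] md mmin.
  by move: md; rewrite expn0 invr1 ltNge d1.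
exists n; rewrite md/= leNgt; apply/negP => /mmin.
by rewrite ltnn.
Qed.

(** Chaining. The approximations of a point at two successive levels are equal or
    neighbours, so they converge geometrically. Two points at distance about
    2^(-n) have equal or neighbouring approximations at level n, and all the
    errors are of order rho^n, that is, of order d(x, y)^delta. *)
Lemma dyadic_increments_holder (phi : R -> R) (C delta : R) : 0 <= C -> 0 < delta ->
  (forall n k, (k < 2 ^ n)%N ->
     `|phi (dyadic n (k.+1 %% 2 ^ n)) - phi (dyadic n k)| <= C * (2 `^ (- delta)) ^+ n) ->
  (forall x, torus x -> cvgn (fun n => phi (dyadic_approx n x))) /\
  torus_holder delta (fun x => limn (fun n => phi (dyadic_approx n x))).
Proof.
move=> C0 d0 Hphi; set rho := 2 `^ (- delta) in Hphi.
have rho0 : 0 < rho by rewrite powR_gt0.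
have rho1 : rho < 1 by exact: powR2N_lt1.
have rho01 : 0 < rho < 1 by rewrite rho0.
have succ x n : torus x ->
    `|phi (dyadic_approx n.+1 x) - phi (dyadic_approx n x)| <= C * rho ^+ n.
  move=> tx; have jn := dyadic_index_lt n x tx.
  rewrite /dyadic_approx; have [->|->] := dyadic_index_succ n x tx.
    by rewrite dyadic_double subrr normr0 mulr_ge0// exprn_ge0// ltW.
  have j1 : ((dyadic_index n x).*2.+1 < 2 ^ n.+1)%N.
    by rewrite expnS; lia.
  rewrite -(dyadic_double n (dyadic_index n x)).
  have := Hphi n.+1 (dyadic_index n x).*2 (ltnW j1); rewrite modn_small//.
  move=> /le_trans; apply; rewrite ler_wpM2l// exprS ler_piMl// ?exprn_ge0// ltW//.
have lims x : torus x -> cvgn (fun n => phi (dyadic_approx n x)) /\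
   forall n, `|limn (fun n => phi (dyadic_approx n x)) - phi (dyadic_approx n x)| <=
     C / (1 - rho) * rho ^+ n.
  by move=> tx; apply: (cvg_geometric_increments (fun n => phi (dyadic_approx n x))) => // n; exact: succ.
split=> [x tx|]; first by have [] := lims x tx.
pose C' := C / (1 - rho).
exists ((C' + C + C') * 2 `^ delta) => x y.
wlog yx : x y / y <= x => [H tx ty|tx ty].
  have [|/ltW xy] := leP y x; first by move=> yx; exact: H.
  by rewrite distrC /torus_dist (distrC x); exact: H.
have [_ Lx] := lims x tx; have [_ Ly] := lims y ty.
have C'0 : 0 <= C' by rewrite divr_ge0// subr_ge0 ltW.
have := torus_dist_ge0 x y tx ty; rewrite le_eqVlt => /predU1P[xy0|xy0].
  rewrite (torus_dist_eq0 x y)// subrr normr0.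
  by rewrite !mulr_ge0 ?powR_ge0// !addr_ge0.
have d01 : 0 < torus_dist x y <= 1 by rewrite xy0 torus_dist_le1.
have [n /andP[n1 n2]] := exists_dyadic_scale _ d01.
have mid : `|phi (dyadic_approx n x) - phi (dyadic_approx n y)| <= C * rho ^+ n.
  have jx := dyadic_index_lt n x tx; have jy := dyadic_index_lt n y ty.
  rewrite /dyadic_approx.
  have [->|->|->] := dyadic_index_near n x y tx ty yx n2.
  - by rewrite subrr normr0 mulr_ge0// exprn_ge0// ltW.
  - exact: Hphi.
  - by rewrite distrC; exact: Hphi.
set gx := limn _; set gy := limn _.
have tri : `|gx - gy| <= (C' + C + C') * rho ^+ n.
  rewrite (_ : gx - gy = (gx - phi (dyadic_approx n x)) +
    (phi (dyadic_approx n x) - phi (dyadic_approx n y)) -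
    (gy - phi (dyadic_approx n y))); last by ring.
  rewrite !mulrDl; apply: (le_trans (ler_normB _ _)); apply: lerD; last exact: Ly.
  apply: (le_trans (ler_normD _ _)); apply: lerD; [exact: Lx|exact: mid].
apply: (le_trans tri); rewrite -mulrA; apply: ler_wpM2l; first by rewrite !addr_ge0.
have -> : rho ^+ n = 2 `^ delta * ((2 ^ n.+1)%:R^-1) `^ delta.
  rewrite /rho -powR_mulrn ?powR_ge0// -powRrM natrX -powR_mulrn// -powRN -powRrM.
  rewrite -powRD; last by rewrite pnatr_eq0 implybT.
  by congr powR; rewrite -natr1; ring.
apply: ler_wpM2l; first exact: powR_ge0.
by apply: ge0_ler_powR; rewrite ?nnegrE ?(ltW d0) ?(ltW xy0) ?(ltW n1)// invr_ge0 ltW.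
Qed.

End dyadic_holder.

(** * A continuity criterion on the torus *)

Section kolmogorov.
Context {d : measure_display} {Omega : measurableType d} {R : realType}.
Variable P : probability Omega R.

(** The Borel-Cantelli lemma, for a geometric rate. *)
Lemma ae_eventually_not (F : nat -> set Omega) (C : R) : 0 <= C ->
  (forall n, measurable (F n)) ->
  (forall n, (P (F n) <= (C * 2^-1 ^+ n)%:E)%E) ->
  {ae P, forall w, exists N, forall n, (N <= n)%N -> ~ F n w}.
Proof.
move=> C0 mF PF.
have sumF : (\sum_(n <oo) P (F n) < +oo)%E.
  apply: (@le_lt_trans _ _ ((C * 2)%:E)); last exact: ltry.
  apply: nneseries_le_partial => [n|n]; first exact: measure_ge0.
  apply: (@le_trans _ _ (\sum_(0 <= i < n) (C * 2^-1 ^+ i)%:E)%E).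
    by apply: lee_sum => i _; exact: PF.
  rewrite sumEFin lee_fin big_mkord -mulr_sumr; apply: ler_wpM2l => //.
  have := subrX1 (2^-1 : R) n; have : 0 < (2^-1 : R) ^+ n by rewrite exprn_gt0.
  lra.
exists (lim_sup_set F); split.
- apply: bigcap_measurable => // k _; apply: bigcup_measurable => j _; exact: mF.
- exact: lim_sup_set_cvg0.
- move=> w /= nF n _; apply: contrapT => nFn; apply: nF; exists n => m nm Fm.
  by apply: nFn; exists m.
Qed.

Lemma torus_dist_dyadic n k : (k < 2 ^ n)%N ->
  torus_dist (dyadic n (k.+1 %% 2 ^ n)) (dyadic n k) <= (2 ^ n)%:R^-1 :> R.
Proof.
move=> kn; have N0 : 0 < (2 ^ n)%:R :> R by rewrite ltr0n expn_gt0.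
rewrite /torus_dist /dyadic -mulrBl normrM [`|_^-1|]ger0_norm ?invr_ge0 ?(ltW N0)//.
move: kn; rewrite leq_eqVlt => /predU1P[kn|kn].
  rewrite kn modnn sub0r normrN normr_nat ge_min; apply/orP; right.
  have -> : k%:R = (2 ^ n)%:R - 1 :> R by rewrite -kn -natr1 addrK.
  by rewrite mulrBl divff ?gt_eqF// mul1r; lra.
rewrite modn_small// -natr1 addrAC subrr add0r normr1 mul1r.
by rewrite ge_min lexx.
Qed.

Lemma dyadic_scale_powR (delta : R) n : (2 `^ (- delta)) ^+ n = ((2 ^ n)%:R^-1) `^ delta.
Proof.
rewrite -powR_mulrn ?powR_ge0// -powRrM natrX -powR_mulrn// -powRN -powRrM.
by congr powR; ring.
Qed.

(** The form of the tail bound used at level n of the dyadic points. *)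
Lemma increment_tail_le (Z : R -> Omega -> R) (delta C : R) n x y :
  0 < delta -> torus x -> torus y ->
  measurable_fun setT (Z x) -> measurable_fun setT (Z y) ->
  (P [set w | (torus_dist x y `^ delta < `|Z x w - Z y w|)%R] <= (C * torus_dist x y ^+ 2)%:E)%E ->
  torus_dist x y <= (2 ^ n)%:R^-1 ->
  measurable [set w | (2 `^ (- delta)) ^+ n < `|Z x w - Z y w|] /\
  (P [set w | ((2 `^ (- delta)) ^+ n < `|Z x w - Z y w|)%R] <= (`|C| * 4^-1 ^+ n)%:E)%E.
Proof.
move=> d0 tx ty mZx mZy PZ dn.
have mgt (b : R) : measurable [set w | b < `|Z x w - Z y w|].
  by apply: measurable_abs_gt_comp; exact: measurable_funB.
have d1 := torus_dist_ge0 x y tx ty.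
split; first exact: mgt.
apply: (@le_trans _ _ (P [set w | (torus_dist x y `^ delta < `|Z x w - Z y w|)%R])).
  apply: le_measure; rewrite ?inE; [exact: mgt..|].
  move=> w /=; apply: le_lt_trans; rewrite dyadic_scale_powR.
  by apply: ge0_ler_powR; rewrite ?nnegrE ?(ltW d0)// invr_ge0.
apply: (le_trans PZ); rewrite lee_fin.
apply: (@le_trans _ _ (`|C| * torus_dist x y ^+ 2)).
  by apply: ler_wpM2r; rewrite ?sqr_ge0 ?ler_norm.
apply: ler_wpM2l => //.
rewrite (_ : 4^-1 ^+ n = ((2 ^ n)%:R^-1) ^+ 2 :> R).
  by rewrite lerXn2r ?nnegrE// invr_ge0.
by rewrite natrX -!exprVn -exprM mulnC exprM; congr (_ ^+ n); field.
Qed.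

(** At level n there are 2^n increments, each of them exceeding rho^n with
    probability of order 4^(-n); the union bound leaves a summable 2^(-n). The
    finitely many levels that are not covered by the Borel-Cantelli lemma are
    absorbed in the constant. *)
Lemma ae_torus_dyadic (Z : R -> Omega -> R) (delta C : R) :
  0 < delta -> (forall x, torus x -> measurable_fun setT (Z x)) ->
  (forall x y, torus x -> torus y ->
    (P [set w | (torus_dist x y `^ delta < `|Z x w - Z y w|)%R]
      <= (C * torus_dist x y ^+ 2)%:E)%E) ->
  {ae P, forall w,
    (forall x, torus x -> cvgn (fun n => Z (dyadic_approx n x) w)) /\
    torus_holder delta (fun x => limn (fun n => Z (dyadic_approx n x) w))}.
Proof.
move=> d0 mZ PZ.
pose A n k := [set w | (2 `^ (- delta)) ^+ n <
   `|Z (dyadic n (k.+1 %% 2 ^ n)) w - Z (dyadic n k) w|].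
have HA n k : (k < 2 ^ n)%N -> measurable (A n k) /\ (P (A n k) <= (`|C| * 4^-1 ^+ n)%:E)%E.
  move=> kn; have k1n : (k.+1 %% 2 ^ n < 2 ^ n)%N by rewrite ltn_mod expn_gt0.
  have tx := dyadic_torus (R := R) _ _ k1n; have ty := dyadic_torus (R := R) _ _ kn.
  apply: increment_tail_le => //; [exact: mZ|exact: mZ|exact: PZ|].
  exact: torus_dist_dyadic.
pose B n := \big[setU/set0]_(k < 2 ^ n) A n k.
have mB n : measurable (B n) by apply: bigsetU_measurable => k _; have [] := HA n k (ltn_ord k).
have PB n : (P (B n) <= (`|C| * 2^-1 ^+ n)%:E)%E.
  apply: (@le_trans _ _ (\sum_(k < 2 ^ n) (`|C| * 4^-1 ^+ n)%:E)%E).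
    apply: (le_trans (Boole_inequality P _)); first by move=> k kn; have [] := HA n k kn.
    by apply: lee_sum => k _; have [] := HA n k (ltn_ord k).
  rewrite sumEFin lee_fin sumr_const card_ord -[_ *+ (2 ^ n)]mulr_natr natrX -mulrA -exprMn.
  by rewrite (_ : 4^-1 * 2 = 2^-1 :> R)//; field.
apply: filterS (ae_eventually_not B `|C| (normr_ge0 _) mB PB) => w [N HN].
set rho := 2 `^ (- delta) in A HA B mB PB HN *.
have rho0 : 0 < rho by rewrite powR_gt0.
pose inc n k := `|Z (dyadic n (k.+1 %% 2 ^ n)) w - Z (dyadic n k) w|.
(* The 1 serves the levels n >= N, the sum the finitely many other ones. *)
pose M := 1 + \sum_(n < N) \sum_(k < 2 ^ n) inc n k / rho ^+ n.
have inc0 n k : 0 <= inc n k / rho ^+ n by apply: divr_ge0; [exact: normr_ge0|rewrite exprn_ge0// ltW].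
have sum0 : 0 <= \sum_(n < N) \sum_(k < 2 ^ n) inc n k / rho ^+ n.
  by apply: sumr_ge0 => n _; apply: sumr_ge0 => k _.
apply: (dyadic_increments_holder (fun x => Z x w) M delta) => //.
  by rewrite addr_ge0.
move=> n k kn; rewrite -/rho.
have [Nn|nN] := leqP N n.
  have /HN nB := Nn.
  apply: (@le_trans _ _ (rho ^+ n)); last first.
    by rewrite ler_peMl ?exprn_ge0 ?(ltW rho0)// lerDl.
  rewrite leNgt; apply/negP => Hk; apply: nB.
  by rewrite /B -bigcup_mkord; exists k.
rewrite -ler_pdivrMr ?exprn_gt0//.
rewrite -/(inc n k) /M (bigD1 (Ordinal nN))//= (bigD1 (Ordinal kn))//=.
have h1 : 0 <= \sum_(i < 2 ^ n | i != Ordinal kn) inc n i / rho ^+ n.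
  by apply: sumr_ge0.
have h2 : 0 <= \sum_(i < N | i != Ordinal nN) \sum_(k < 2 ^ i) inc i k / rho ^+ i.
  by apply: sumr_ge0 => i _; apply: sumr_ge0.
lra.
Qed.

(** The tail bound is what Kolmogorov's moment condition is used for. Defining
    the modification as an upper limit along dyadic approximations makes it
    measurable everywhere and the same for all exponents; these are reduced to
    countably many by monotonicity. *)
Lemma kolmogorov_torus (Z : R -> Omega -> R) (delta0 : R) : 0 < delta0 ->
  (forall x, torus x -> measurable_fun setT (Z x)) ->
  (forall delta, 0 < delta < delta0 -> exists C : R, forall x y, torus x -> torus y ->
    (P [set w | (torus_dist x y `^ delta < `|Z x w - Z y w|)%R]
      <= (C * torus_dist x y ^+ 2)%:E)%E) ->
  as_holder_below P delta0 Z.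
Proof.
move=> d00 mZ PZ.
pose g x w := fine (limn_esup (fun n => (Z (dyadic_approx n x) w)%:E)).
have gE x w : cvgn (fun n => Z (dyadic_approx n x) w) ->
    g x w = limn (fun n => Z (dyadic_approx n x) w).
  move=> cu; rewrite /g is_cvg_limn_esupE.
    by rewrite EFin_lim.
  apply/cvg_ex; exists (limn (fun n => Z (dyadic_approx n x) w))%:E.
  by apply: cvg_EFin => //; exact: nearW.
exists g.
  move=> x tx; split.
    apply: (measurableT_comp (fine_measurable measurableT)).
    apply: measurable_fun_limn_esup => n; apply/measurable_EFinP.
    by apply: mZ; exact: dyadic_approx_torus.
  pose delta := delta0 / 2.
  have d0 : 0 < delta by rewrite divr_gt0.
  have d01 : 0 < delta < delta0 by rewrite d0 /delta; lra.
  have [C HC] := PZ delta d01.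
  pose F n := [set w | (2 `^ (- delta)) ^+ n < `|Z x w - Z (dyadic_approx n x) w|].
  have HF n : measurable (F n) /\ (P (F n) <= (`|C| * 4^-1 ^+ n)%:E)%E.
    have ta := dyadic_approx_torus n x tx.
    apply: increment_tail_le => //; [exact: mZ|exact: mZ|exact: HC|].
    by rewrite (le_trans _ (dyadic_approx_dist n x tx))// ge_min lexx.
  have mF n : measurable (F n) by have [] := HF n.
  have PF n : (P (F n) <= (`|C| * 2^-1 ^+ n)%:E)%E.
    have [_ /le_trans] := HF n; apply; rewrite lee_fin; apply: ler_wpM2l => //.
    by apply: lerXn2r; rewrite ?nnegrE; lra.
  apply: filterS (ae_eventually_not F `|C| (normr_ge0 _) mF PF) => w [N HN].
  have cu : Z (dyadic_approx n x) w @[n --> \oo] --> Z x w.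
    apply/cvgrPdist_le => e e0.
    have rho01 : `|2 `^ (- delta) : R| < 1.
      by rewrite ger0_norm ?powR_ge0// powR2N_lt1.
    have /cvgrPdist_lt /(_ e e0) [M _ HM] := cvg_expr rho01.
    exists (maxn N M) => // n /=; rewrite geq_max => /andP[Nn Mn].
    have := HM n Mn; rewrite /= sub0r normrN => re.
    rewrite (le_trans _ (ltW re))// (le_trans _ (ler_norm _))//.
    by rewrite leNgt; apply/negP; exact: HN.
  rewrite gE; first by apply: cvg_lim.
  by apply/cvg_ex; exists (Z x w).
(* A sequence of exponents increasing to delta0. *)
pose dl (j : nat) := delta0 * (j.+1%:R / j.+2%:R).
have dl01 j : 0 < dl j < delta0.
  rewrite /dl mulr_gt0 ?divr_gt0//= gtr_pMr// ltr_pdivrMr// mul1r.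
  by rewrite ltr_nat.
have aej : {ae P, forall w, forall j : nat,
    (forall x, torus x -> cvgn (fun n => Z (dyadic_approx n x) w)) /\
    torus_holder (dl j) (fun x => limn (fun n => Z (dyadic_approx n x) w))}.
  apply: ae_foralln => j; have [C HC] := PZ (dl j) (dl01 j).
  by have /andP[dl0 _] := dl01 j; exact: (ae_torus_dyadic Z (dl j) C).
apply: filterS aej => w Hw delta /andP[d0 dd].
have [j dj] : exists j, delta <= dl j.
  exists (Num.truncn (delta / (delta0 - delta))); set j := Num.truncn _.
  have := truncnS_gt (delta / (delta0 - delta)); rewrite -/j.
  rewrite ltr_pdivrMr ?subr_gt0// => Hj.
  rewrite /dl mulrA ler_pdivlMr// -natr1 mulrDr mulr1; move: Hj; nra.
have [cw [C HC]] := Hw j.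
apply: (torus_holder_le delta (dl j)); first by rewrite d0.
exists C => x y tx ty; rewrite !gE; [exact: HC|exact: cw|exact: cw].
Qed.

End kolmogorov.

(** * The stochastic convolution and the solution *)

Section convolution.
Context {d : measure_display} {Omega : measurableType d} {R : realType}.
Variable P : probability Omega R.

(** Since exp z >= z^m / m!, any power of x is available; m is chosen so that
    e m >= 2. *)
Lemma expR_opp_le_powR (e K : R) : 0 < e -> 0 < K ->
  exists C : R, forall x, 0 < x <= 1 -> expR (- (x `^ (- e) / K)) <= C * x ^+ 2.
Proof.
move=> e0 K0; pose m := Num.truncn (2 / e).
have me : 2 <= e * m.+1%:R.
  by rewrite mulrC -ler_pdivrMr// ltW// truncnS_gt.
exists ((m.+1)`!%:R * K ^+ m.+1) => x /andP[x0 x1].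
set z := x `^ (- e) / K.
have z0 : 0 < z by rewrite divr_gt0// powR_gt0.
have f0 : 0 < (m.+1)`!%:R :> R by rewrite ltr0n fact_gt0.
apply: (@le_trans _ _ ((m.+1)`!%:R / z ^+ m.+1)).
  rewrite expRN -[leRHS]invf_div lef_pV2 ?posrE ?expR_gt0 ?divr_gt0 ?exprn_gt0//.
  by apply: le_trans (expR_ge1Dxn m (ltW z0)); rewrite lerDr.
rewrite -mulrA; apply: ler_wpM2l; first exact: ltW.
rewrite /z exprMn exprVn invfM invrK mulrC; apply: ler_wpM2l.
  by rewrite exprn_ge0// ltW.
rewrite powRN exprVn invrK -powR_mulrn ?powR_ge0// -powRrM -[leRHS]powR_mulrn ?(ltW x0)//.
by apply: ger_powR; rewrite ?x0.
Qed.

Lemma white_noise_le (t T : R) (W : set (R * R) -> Omega -> R) : t <= T ->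
  white_noise P T W -> white_noise P t W.
Proof.
move=> tT [hG hcov].
have sub : spacetime t `<=` spacetime T.
  by move=> z [z1 z2]; split => //; move: z1; rewrite /= !in_itv/= => /andP[-> /le_trans]; exact.
split=> [h hh|A B mA At mB Bt].
  by apply: hG => cA /hh[mc ct]; split=> //; exact: subset_trans ct sub.
by apply: hcov => //; [exact: subset_trans At sub|exact: subset_trans Bt sub].
Qed.

(** The order eta = delta + 1/2 of the variance satisfies 2 delta < eta < 1. Hence
    the Gaussian exponent d^(2 delta) / d^eta is a negative power of the
    distance d, and the tail is smaller than d^2. *)
Lemma stochastic_convolution_holder (T : R) (W : set (R * R) -> Omega -> R)
    (X : R -> R -> Omega -> R) (t : R) : white_noise P T W ->
  stochastic_convolution P T W X -> 0 <= t <= T ->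
  as_holder_below P (1 / 2) (X t).
Proof.
move=> hW hX tT; have /andP[t0 tT'] := tT.
have hWt := white_noise_le t T W tT' hW.
apply: kolmogorov_torus => //.
  by move=> x tx; have [] := hX t x tT tx.
move=> delta /andP[d0 d12].
pose eta := delta + 1 / 2.
have e01 : 0 < eta < 1 by rewrite /eta; lra.
have [K [K0 HK]] := heat_kernel_increment_L2 t eta t0 e01.
have e0 : 0 < 1 / 2 - delta by lra.
have KK : 0 < 32 * 36 * K by rewrite !mulr_gt0.
have [C HC] := expR_opp_le_powR (1 / 2 - delta) (32 * 36 * K) e0 KK.
exists (2 * C) => x y tx ty.
have := torus_dist_ge0 x y tx ty; rewrite le_eqVlt => /predU1P[xy0|xy0].
  have xy : x = y by apply: torus_dist_eq0.
  rewrite (_ : [set w | _] = set0); last first.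
    by apply/seteqP; split => w //=; rewrite xy subrr normr0 ltNge powR_ge0.
  by rewrite measure0 lee_fin -xy0 expr0n/= mulr0.
have xy1 : 0 < torus_dist x y <= 1 by rewrite xy0 torus_dist_le1.
have mhk x' : measurable_fun setT (fun z : R * R => heat_kernel (t - z.1) (x' - z.2)).
  by apply: measurable_heat_kernel; exact: measurable_funB.
have v0 : 0 < K * torus_dist x y `^ eta by rewrite mulr_gt0// powR_gt0.
have l0 : 0 < torus_dist x y `^ delta by rewrite powR_gt0.
have := wiener_integral_sub_tail P t W hWt _ _ _ _ _ _ (hX t x tT tx) (hX t y tT ty)
  (mhk x) (mhk y) v0 l0 (HK x y tx ty).
move=> /le_trans; apply; rewrite lee_fin -mulrA ler_pM2l//.
apply: le_trans (HC _ xy1); rewrite ler_expR le_eqVlt; apply/orP; left; apply/eqP.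
rewrite mulNr; congr (- _).
have -> : torus_dist x y `^ (- (1 / 2 - delta)) =
    (torus_dist x y `^ delta) ^+ 2 / torus_dist x y `^ eta.
  rewrite -powR_mulrn ?powR_ge0// -powRrM -powRN -powRD; last first.
    by rewrite (gt_eqF xy0) implybT.
  by congr powR; rewrite /eta; field.
have De : torus_dist x y `^ eta != 0 by rewrite gt_eqF// powR_gt0.
by field; rewrite De gt_eqF.
Qed.

End convolution.

Theorem corollary3p5 (R : realType) (d : measure_display)
    (Omega : measurableType d) (P : probability Omega R)
    (T : R) (hT : 0 < T)
    (W : set (R * R) -> Omega -> R) (hW : white_noise P T W)
    (X u : R -> R -> Omega -> R) (hu : mild_solution P T W X u)
    (hmom : bounded_moments P T u)
    (beta : R) (hbeta : 2 < beta < 3) :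
  (forall t : R, 0 <= t <= T ->
     as_holder_below P (2 / beta) (drift_part u t)) /\
  (forall t : R, 0 <= t <= T ->
     as_holder_below P (1 / 2) (u t)).
Proof.
have [hX hu_meas hXY] := hu.
have /andP[b2 b3] := hbeta.
split=> t tT.
  apply: (drift_part_as_holder P T u hT hu_meas hmom) => //.
  have b0 : 0 < beta by lra.
  by rewrite divr_gt0//= ltr_pdivrMr// mul1r.
have half01 : 0 < (1 / 2 : R) < 1 by lra.
have [Y hY Yholder] := drift_part_as_holder P T u hT hu_meas hmom (1 / 2) t half01 tT.
have [Z hZ Zholder] := stochastic_convolution_holder P T W X t hW hX tT.
exists (fun x w => Z x w + Y x w).
  move=> x tx; have [mZ ZX] := hZ x tx; have [mY YD] := hY x tx.
  split; first exact: measurable_funD.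
  by apply: filterS3 ZX YD (hXY t x tT tx) => w -> -> ->.
apply: filterS2 Zholder Yholder => w Zw Yw delta d01.
have [C1 HC1] := Zw delta d01; have [C2 HC2] := Yw delta d01.
exists (C1 + C2) => x y tx ty.
rewrite opprD addrACA mulrDl.
by apply: (le_trans (ler_normD _ _)); apply: lerD; [exact: HC1|exact: HC2].
Qed.
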